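(* Let $f$ and $g$ be complex polynomials of the same degree $d\geq 2$. Then the following are equivalent: (i) $f^n\sim g^n$ for infinitely many integers $n\geq 1$; (ii) $f^n\sim g^n$ for all integers $n\geq 1$; (iii) there is an affine transformation $A$ with $A(J(g))=J(f)$. Call $f$ and $g$ strongly equivalent if they satisfy these conditions. Then each strong equivalence class consists of finitely many affine conjugacy classes; their number is no more than the order of the symmetry group of the Julia set.
   Context: $f^n$ is the $n$-th iterate and $J(f)$ the Julia set of $f$. Affine transformations are maps $A(z)=az+b$ with $a,b\in\mathbb{C}$, $a\ne0$. The Schwarzian derivative is $S_h=\frac{h'''}{h'}-\frac32\left(\frac{h''}{h'}\right)^2$. For polynomials $p,q$ of the same degree $\geq2$, $p\sim q$ means there is an affine transformation $A(z)=az+b$ with $S_p\,dz^2=A^*(S_q\,dz^2)$, i.e. $S_p(z)=S_q(az+b)\,a^2$. Two polynomials are affinely conjugate if $g=A^{-1}\circ f\circ A$ for some affine $A$. The symmetry group of the Julia set $J$ is the group of maps $\sigma(z)=az+b$ with $|a|=1$ and $\sigma(J)=J$ (it may be infinite, namely when $J$ is a circle). *)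

(* Defs.v *)
From HB Require Import structures.
From mathcomp Require Import all_boot all_order all_algebra.
From mathcomp Require Import all_classical all_reals all_analysis.
From mathcomp Require Import complex.

Set Implicit Arguments.
Unset Strict Implicit.
Unset Printing Implicit Defensive.

Import Order.TTheory GRing.Theory Num.Theory.
Import numFieldNormedType.Exports.

Local Open Scope classical_set_scope.
Local Open Scope ring_scope.

(* R[i] with its numClosedFieldType packaging, through which the library's
   topology and norm are found; the norm `|z| : CC R is CC R-valued. *)
Definition CC (R : realType) : numClosedFieldType := R[i].

Section Defs.
Variable R : realType.
Local Notation C := (CC R).
Implicit Types (f g p q h : {poly C}) (a b z : C) (U K J : set C).

Definition iterp f (n : nat) : {poly C} := iter n (fun q => f \Po q) 'X.

Definition affine a b : {poly C} := a *: 'X + b%:P.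

Definition affine_inv a b : {poly C} := a^-1 *: ('X - b%:P).

(* The limit [l] is the finite case of spherical convergence; the second
   alternative is convergence to the constant infinity.  On a disc these are
   the only possible spherical limits of holomorphic functions. *)
Definition normal_on U (F : nat -> C -> C) : Prop :=
  forall u : nat -> nat, exists phi : nat -> nat,
    {homo phi : m n / (m < n)%N >-> (m < n)%N} /\
    ((exists l : C -> C,
        {family [set K | compact K /\ K `<=` U],
           (fun k => F (u (phi k))) @ \oo --> l}) \/
     (forall K, compact K -> K `<=` U -> forall M : R,
        \forall k \near \oo, forall z, K z -> (M%:C%C : C) < `|F (u (phi k)) z|)).

Definition fatou f : set C :=
  [set z | exists2 U, open_nbhs z U &
             normal_on U (fun n => horner (iterp f n))].

(* For a polynomial of degree at least 2 infinity is in the Fatou set, so the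
   complement can be taken in the plane. *)
Definition julia f : set C := ~` fatou f.

Definition schwarzian h z : C :=
  h^`(3).[z] / h^`().[z] - 3%:R / 2%:R * (h^`(2).[z] / h^`().[z]) ^+ 2.

(* An identity between rational functions: the two guards only discard the
   poles, where [schwarzian] takes a junk value. *)
Definition schwarz_equiv p q : Prop :=
  exists a b, a != 0 /\
    forall z, p^`().[z] != 0 -> q^`().[a * z + b] != 0 ->
      schwarzian p z = schwarzian q (a * z + b) * a ^+ 2.

Definition affine_conj f g : Prop :=
  exists a b, a != 0 /\ g = affine_inv a b \Po (f \Po affine a b).

Definition iterates_equiv_often f g : Prop :=
  infinite_set [set n : nat | (1 <= n)%N /\
                              schwarz_equiv (iterp f n) (iterp g n)].

Definition iterates_equiv_always f g : Prop :=
  forall n : nat, (1 <= n)%N -> schwarz_equiv (iterp f n) (iterp g n).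

Definition julia_affine_equiv f g : Prop :=
  exists a b, a != 0 /\ horner (affine a b) @` julia g = julia f.

Definition strong_equiv f g : Prop :=
  [/\ iterates_equiv_often f g, iterates_equiv_always f g &
      julia_affine_equiv f g].

Definition strong_class f : set {poly C} :=
  [set g : {poly C} | size g = size f /\ strong_equiv f g].

Definition conj_class g : set {poly C} := [set h | affine_conj g h].

Definition conj_classes_in f : set (set {poly C}) :=
  conj_class @` strong_class f.

Definition symmetry_group J : set (C -> C) :=
  [set s | exists a b, `|a| = 1 /\ s = (fun z => a * z + b) /\ s @` J = J].

End Defs.

(* Main.v *)
Require Import Defs.
From mathcomp Require Import all_boot all_order all_algebra.
From mathcomp Require Import all_classical all_reals all_analysis.
From mathcomp Require Import complex.
From mathcomp Require Import ring lra zify.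

(* The Schwarzian identity between polynomials [p] and [q] means
   [p = L o q o M] with [L], [M] affine, and the right factor of a polynomial
   of given degree in a decomposition is unique up to affine maps. Hence an
   equivalence of f^m and g^m descends, with the same [M], to all n <= m.
   For centred f and g these [M] are homotheties, which lie in a finite set
   unless g = b X^d; a common one for all n gives, after a homothety, f = u g
   with u a root of unity and g(u z) = u^d g(z), so f and g have the same Julia
   set.

   Conversely let J be compact with at least two points, and p, q of the same
   degree with p^-1(J) = J = q^-1(J). If c is the centre of the smallest disc
   containing J, then p - c and q - c are both Chebyshev polynomials of J up to
   scaling, so q - c = u (p - c) with |u| = 1. The uniqueness is obtained by
   averaging q over the fibres of p. Applied to f^n and a conjugate of g^n this
   gives the equivalence of all iterates; applied to f and a conjugate of g it
   writes g, up to conjugacy, as a rotation about c composed with f, the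
   rotation being a symmetry of J. *)

Set Implicit Arguments.
Unset Strict Implicit.
Unset Printing Implicit Defensive.

Import Order.TTheory GRing.Theory Num.Theory.
Import numFieldNormedType.Exports.

Local Open Scope classical_set_scope.
Local Open Scope card_scope.
Local Open Scope ring_scope.

(** * Polynomials over an algebraically closed field of characteristic zero *)

Section Poly.
Variable C : numClosedFieldType.
Implicit Types (p q h P Q W H L M : {poly C}) (s t : seq C) (a b c w z : C).

(** The mean of [q] over the fibre of [p] above [w], counted with multiplicity, is an affine
    function of [w] whose linear coefficient is the ratio of the leading coefficients. For [w] in J
    it stays in every disc containing J, because discs are convex; comparing smallest discs makes
    this affine map a rotation about c. Where [w] lies on the boundary circle, equality in the
    triangle inequality makes [q] constant on the whole fibre. One such contact point would supply
    too few zeros for a degree count; a smallest disc of a set with two points always has two.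

    The family b X^d is the obstacle on both sides. Its Julia set is a circle, any homothety can
    serve as M, and the symmetry group gives no finite bound. There a (d-1)-th root provides the
    homothety that matches leading coefficients. *)

Lemma coefM_top p q (m n : nat) : (size p <= m.+1)%N -> (size q <= n.+1)%N ->
  (p * q)`_(m + n) = p`_m * q`_n.
Proof.
move=> sp sq; rewrite coefM (bigD1 (inord m)) //= inordK ?ltnS ?leq_addr //.
rewrite addKn big1 ?addr0 // => -[i /= lti] /eqP nei.
have {}nei : i <> m by move=> e; apply: nei; apply/val_inj; rewrite /= inordK ?e // ltnS leq_addr.
have [lt|le] := ltnP m i; first by rewrite nth_default ?mul0r // (leq_trans sp).
rewrite [q`__]nth_default ?mulr0 // (leq_trans sq) //.
by lia.
Qed.

(** The hypothesis says that [P ^+ k] and [Q ^+ l] have the same logarithmic derivative; derivation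
    brings down the degree in the leading coefficients. The factor ['X] in the proof restores the
    degree lost by derivation, so that constants need no separate case. *)
Lemma log_deriv_degree P Q (k l : nat) : P != 0 -> Q != 0 ->
  (Q * P^`()) *+ k = (P * Q^`()) *+ l -> ((size P).-1 * k = (size Q).-1 * l)%N.
Proof.
move=> P0 Q0 e; have := congr1 (fun p => ('X * p)`_((size Q).-1 + (size P).-1)) e.
have sp (p : {poly C}) : p != 0 -> (size p <= (size p).-1.+1)%N.
  by rewrite -size_poly_gt0 => /prednK->.
have sd (p : {poly C}) : p != 0 -> (size ('X * p^`())%R <= (size p).-1.+1)%N.
  by move=> p0; have := size_polyMleq 'X p^`(); have := lt_size_deriv p0; rewrite size_polyX; lia.
have cd (p : {poly C}) : ('X * p^`())`_(size p).-1 = p`_(size p).-1 *+ (size p).-1.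
  by rewrite coefXM; case: (size p).-1 => [|m] /=; rewrite ?mulr0n // coef_deriv.
rewrite !mulrnAr !coefMn !(mulrCA 'X) coefM_top ?sp ?sd // cd.
rewrite addnC coefM_top ?sp ?sd // cd -!mulrnAr -!mulrnA !mulrnAr mulrC.
move=> /eqP; rewrite -subr_eq0 -[X in X - _]mulr_natr -[X in _ - X]mulr_natr -mulrBr mulf_eq0.
rewrite mulf_eq0 -!lead_coefE !lead_coef_eq0 (negPf P0) (negPf Q0) /= subr_eq0.
by rewrite eqr_nat => /eqP.
Qed.

(** Once the leading terms are cancelled, the difference still satisfies the equation, so it has the
    degree of [H]; but its coefficient there is zero. *)
Lemma wronskian_eq0_proportional P H : size P = size H -> H != 0 ->
  P^`() * H = P * H^`() -> P = (lead_coef P / lead_coef H) *: H.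
Proof.
move=> sPH H0 e; set c := _ / _; apply/eqP; rewrite -subr_eq0; apply/negPn/negP.
set D := P - _ => D0.
have eD : H * D^`() *+ 1 = D * H^`() *+ 1.
  by rewrite !mulr1n derivB derivZ mulrBr mulrBl mulrC e -scalerAr -scalerAl [H * _]mulrC.
have := @log_deriv_degree D H 1 1 D0 H0 eD; rewrite !muln1 => sD.
have : lead_coef D = 0.
  rewrite lead_coefE sD coefB coefZ -[H`__]lead_coefE -sPH -lead_coefE /c.
  by rewrite divfK ?subrr // lead_coef_eq0.
by move/eqP; rewrite lead_coef_eq0 (negPf D0).
Qed.

(* With [W] the Wronskian, the hypothesis reads [2 (P H) W' = 3 W (P H)'], which
   is impossible for [W != 0] since [deg W < deg (P H)]. *)
Lemma schwarzian_eq_wronskian P H : P != 0 -> H != 0 ->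
  (P^`(2) * P *+ 2 - P^`() ^+ 2 *+ 3) * H ^+ 2 =
  (H^`(2) * H *+ 2 - H^`() ^+ 2 *+ 3) * P ^+ 2 ->
  P^`() * H = P * H^`().
Proof.
move=> P0 H0 e; apply/eqP; rewrite -subr_eq0; apply/negPn/negP.
set W := _ - _ => W0.
have Q0 : P * H != 0 by rewrite mulf_neq0.
have eW : (P * H) * W^`() *+ 2 = W * (P * H)^`() *+ 3.
  rewrite derivB !derivM /W; move: e; rewrite !derivSn !derivn0.
  set P2 := P^`()^`(); set H2 := H^`()^`(); set P1 := P^`(); set H1 := H^`() => e.
  apply/eqP; rewrite -subr_eq0; apply/eqP.
  transitivity ((P2 * P *+ 2 - P1 ^+ 2 *+ 3) * H ^+ 2 - (H2 * H *+ 2 - H1 ^+ 2 *+ 3) * P ^+ 2);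
    last by rewrite e subrr.
  by ring.
have := @log_deriv_degree W (P * H) 2 3 W0 Q0 eW.
have sQ : size (P * H) = ((size P).-1 + (size H).-1).+1.
  rewrite size_mul //; move: P0 H0; rewrite -!size_poly_gt0.
  by case: (size P) (size H) => [|m] [|n] //= _ _; rewrite addnS.
rewrite sQ /=.
have : (size W <= ((size P).-1 + (size H).-1))%N.
  apply: leq_trans (size_polyD _ _) _; rewrite size_polyN geq_max; apply/andP; split.
    apply: leq_trans (size_polyMleq _ _) _; move: (lt_size_deriv P0) H0.
    by rewrite -size_poly_gt0; case: (size P) (size H) => [|m] [|n] //= l _; rewrite addnS /= leq_add2r.
  apply: leq_trans (size_polyMleq _ _) _; move: (lt_size_deriv H0) P0.
  by rewrite -size_poly_gt0; case: (size H) (size P) => [|m] [|n] //= l _; rewrite leq_add2l.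
move: W0; rewrite -size_poly_gt0; move: (size W) ((size P).-1 + _)%N => [//|w] n _ /=.
by lia.
Qed.

(** * Uniqueness of the right factor of a composition *)

Lemma size_exp_top p (n i : nat) : (size p <= n.+1)%N -> (size (p ^+ i)%R <= (n * i).+1)%N.
Proof.
move=> sp; elim: i => [|i IH]; first by rewrite expr0 size_poly1 muln0.
by rewrite exprS; have := size_polyMleq p (p ^+ i); rewrite mulnS; lia.
Qed.

Lemma coefX_top p (n i : nat) : (size p <= n.+1)%N -> (p ^+ i)`_(n * i) = p`_n ^+ i.
Proof.
move=> sp; elim: i => [|i IH]; first by rewrite muln0 !expr0 coef1.
by rewrite !exprS mulnS coefM_top ?IH // size_exp_top.
Qed.

Lemma size_sub_lead p (n : nat) : (size p <= n.+1)%N -> (size (p - p`_n *: 'X^n)%R <= n)%N.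
Proof.
move=> sp; apply/leq_sizeP => j; rewrite leq_eqVlt coefB coefZ coefXn => /orP[/eqP<-|lt].
  by rewrite eqxx mulr1 subrr.
by rewrite gtn_eqF // mulr0 subr0 nth_default // (leq_trans sp).
Qed.

(** With [a] matching the leading coefficients of [q] and [a *: p], the terms of lower degree in [P]
    and [Q] bound the degree of [q ^+ k.+1 - (a *: p) ^+ k.+1] by [k * m.+1]. The cofactor of
    [q - a *: p] in it is a sum of [k.+1] terms with equal leading coefficient, hence already has
    that degree in characteristic zero, and [q - a *: p] must be constant. *)
Lemma comp_poly_left_unique P Q p q (m k : nat) :
  size p = m.+2 -> size q = m.+2 -> size P = k.+2 -> size Q = k.+2 ->
  P \Po p = Q \Po q -> exists a b, a != 0 /\ q = a *: p + b%:P.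
Proof.
move=> sp sq sP sQ e.
have lp : lead_coef p = p`_m.+1 by rewrite lead_coefE sp.
have lq : lead_coef q = q`_m.+1 by rewrite lead_coefE sq.
have p0 : p`_m.+1 != 0 by rewrite -lp lead_coef_eq0 -size_poly_eq0 sp.
have q0 : q`_m.+1 != 0 by rewrite -lq lead_coef_eq0 -size_poly_eq0 sq.
have Q0 : Q`_k.+1 != 0.
  by rewrite -[k.+1]/(k.+2.-1) -sQ -lead_coefE lead_coef_eq0 -size_poly_eq0 sQ.
have lead : P`_k.+1 * p`_m.+1 ^+ k.+1 = Q`_k.+1 * q`_m.+1 ^+ k.+1.
  have := congr1 lead_coef e; rewrite !lead_coef_comp ?sp ?sq // !(lead_coefE P, lead_coefE Q).
  by rewrite sP sQ lp lq.
pose a := q`_m.+1 / p`_m.+1.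
have a0 : a != 0 by rewrite mulf_neq0 // invr_eq0.
pose r := q - a *: p.
suff sr : (size r <= 1)%N.
  by exists a, r`_0; split => //; rewrite -(size1_polyC sr) /r addrC subrK.
have ePQ : Q`_k.+1 *: (q ^+ k.+1 - (a *: p) ^+ k.+1) =
    ((P - P`_k.+1 *: 'X^(k.+1)) \Po p) - ((Q - Q`_k.+1 *: 'X^(k.+1)) \Po q).
  rewrite !comp_polyB !comp_polyZ !comp_Xn_poly e exprZn scalerBr scalerA.
  have -> : Q`_k.+1 * a ^+ k.+1 = P`_k.+1.
    by rewrite /a expr_div_n mulrA -lead mulfK // expf_neq0.
  by rewrite opprB [RHS]addrC addrA subrK.
have sz : (size (q ^+ k.+1 - (a *: p) ^+ k.+1)%R <= (k * m.+1).+1)%N.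
  rewrite -(size_scale _ Q0) ePQ; apply: leq_trans (size_polyD _ _) _.
  rewrite size_polyN geq_max; apply/andP; split; apply: leq_trans (size_comp_poly_leq _ _) _.
    by rewrite sp ltnS leq_mul // -subn1 leq_subLR add1n; apply: size_sub_lead; rewrite sP.
  by rewrite sq ltnS leq_mul // -subn1 leq_subLR add1n; apply: size_sub_lead; rewrite sQ.
move: sz; rewrite subrXX /=; set S := \sum_(i < _) _ => sz.
have cS : S`_(m.+1 * k) = (q`_m.+1 ^+ k) *+ k.+1.
  rewrite /S coef_sum -[k.+1 in RHS]card_ord -sumr_const; apply: eq_bigr => i _.
  have lei : (i <= k)%N by rewrite -ltnS.
  have sap : (size (a *: p)%R <= m.+2)%N by rewrite size_scale ?sp.
  have -> : (m.+1 * k = m.+1 * (k - i) + m.+1 * i)%N by rewrite -mulnDr subnK.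
  rewrite coefM_top ?size_exp_top ?sq //.
  rewrite !coefX_top ?sq // coefZ /a divfK // -exprD subnK //.
have S0 : S`_(m.+1 * k) != 0 by rewrite cS mulrn_eq0 expf_eq0 (negPf q0) andbF.
have sS : (m.+1 * k < size S)%N.
  by rewrite ltnNge; apply: contra S0 => le; rewrite nth_default.
have [r0|r0] := eqVneq r 0; first by rewrite r0 size_poly0.
have S0' : S != 0 by apply: contraTneq sS => ->; rewrite size_poly0.
move: sz; rewrite -/r size_mul // => sz; rewrite mulnC in sS.
move: sz sS; move: (size r) (size S) (k * m.+1)%N; lia.
Qed.

(** * Sums over the fibres of a polynomial *)

Lemma prod_XsubC_monic s : \prod_(z <- s) ('X - z%:P) \is monic.
Proof. by apply: monic_prod => z _; apply: monicXsubC. Qed.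

(* [N] is the remainder of [h P'] modulo [P], seen as the Lagrange-type sum of
   the [h(z) P / (X - z)] over the roots [z] of [P]. *)
Lemma fibre_sum_rem h s : let P := \prod_(z <- s) ('X - z%:P) in
  exists V N, [/\ h * P^`() = P * V + N, (size N <= size s)%N &
    ('X * N)`_(size s) = \sum_(z <- s) h.[z]].
Proof.
elim: s => [|a s [V [N [e sN cN]]]] /=.
  by exists 0, 0; rewrite !big_nil size_poly0 -polyC1 derivC !mulr0 coef0 addr0.
rewrite !big_cons; set Q := \prod_(z <- s) _ in e *.
have [W eW] : exists W, h - h.[a]%:P = W * ('X - a%:P).
  by apply/factor_theorem; rewrite rootE hornerD hornerN hornerC subrr.
have sQ : size Q = (size s).+1 by rewrite size_prod_XsubC.
have Qt : Q`_(size s) = 1.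
  by have /monicP := prod_XsubC_monic s; rewrite lead_coefE -/Q sQ.
exists (W + V), (h.[a] *: Q + ('X - a%:P) * N); split.
- rewrite derivM derivXsubC mul1r mulrDr mulrCA e -mul_polyC.
  have -> : h = W * ('X - a%:P) + h.[a]%:P by rewrite -eW subrK.
  rewrite hornerD hornerM hornerXsubC subrr mulr0 add0r hornerC; ring.
- apply: leq_trans (size_polyD _ _) _; rewrite geq_max (leq_trans (size_scale_leq _ _)) ?sQ //=.
  by rewrite (leq_trans (size_polyMleq _ _)) // size_XsubC add2n ltnS.
- rewrite coefXM /= coefD coefZ Qt mulr1 mulrBl coefB cN coefCM.
  by rewrite [N`__]nth_default // mulr0 subr0.
Qed.

(** Newton's identities express power sums of exponent below the degree without the constant term.
    The proof is by division: [P] and [P + w] have the same derivative, so both divisions give the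
    same quotient, whose degree is too small to change the top coefficient of the remainder. *)
Lemma fibre_sum_const h s t w : (size h <= size s)%N -> size t = size s ->
  \prod_(z <- t) ('X - z%:P) = \prod_(z <- s) ('X - z%:P) + w%:P ->
  \sum_(z <- t) h.[z] = \sum_(z <- s) h.[z].
Proof.
move=> sh st e; have [V [N [e1 sN <-]]] := fibre_sum_rem h s.
have [V2 [N2 [e2 sN2 <-]]] := fibre_sum_rem h t.
move: e1 e2; rewrite e derivD derivC addr0; set P := \prod_(z <- s) _.
have sP : size P = (size s).+1 by rewrite size_prod_XsubC.
have P0 : P != 0 by rewrite -size_poly_eq0 sP.
have sPw : size (P + w%:P) = (size s).+1.
  by rewrite -e size_prod_XsubC st.
move=> e1 e2; rewrite st !coefXM; case: eqP => // s0.
have sV : (size V < size s)%N.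
  have [->|V0] := eqVneq V 0; first by rewrite size_poly0; lia.
  have : size (P * V) = (size s + size V)%N by rewrite size_mul // sP.
  have -> : P * V = h * P^`() - N by rewrite e1 addrK.
  have := size_polyD (h * P^`()) (- N); rewrite size_polyN.
  have := size_polyMleq h P^`(); have := lt_size_deriv P0; rewrite sP.
  rewrite -(size_poly_gt0 V) in V0 => A B D E.
  move: A B D V0 sN sh s0; rewrite E.
  by move: (size (h * P^`())) (size P^`()) (size h) (size s) (size N) (size V); lia.
have eV : (P + w%:P) * (V - V2) = N2 - N + w *: V.
  by rewrite -mul_polyC; apply/eqP; rewrite -subr_eq0; apply/eqP;
    transitivity ((P * V + N) - ((P + w%:P) * V2 + N2)); [ring|rewrite -e1 -e2 subrr].
have VV : V = V2.
  apply/eqP; rewrite -subr_eq0; apply/negPn/negP => D0.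
  have : (size ((P + w%:P) * (V - V2))%R <= size s)%N.
    rewrite eV (leq_trans (size_polyD _ _)) // geq_max (leq_trans (size_polyD _ _)) /=.
      by rewrite (leq_trans (size_scale_leq _ _)) // ltnW.
    by rewrite size_polyN geq_max sN -st sN2.
  rewrite size_mul //; last by rewrite -size_poly_eq0 sPw.
  rewrite -size_poly_gt0 in D0; rewrite sPw.
  by move: D0; move: (size (V - V2)) (size s); lia.
move: eV; rewrite VV subrr mulr0 -VV => /(congr1 (fun p : {poly C} => p`_(size s).-1)).
rewrite coef0 coefD coefB coefZ [V`__]nth_default ?mulr0 ?addr0; last by case: (size s) sV.
by move/esym/eqP; rewrite subr_eq0 => /eqP.
Qed.

(** At a root of multiplicity m the derivative supplies m - 1 of the factors and [h] the last one.
    Critical fibres are thus no exception. *)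
Lemma dvdp_prod_deriv h s : {in s, forall z, root h z} ->
  \prod_(z <- s) ('X - z%:P) %| (\prod_(z <- s) ('X - z%:P))^`() * h.
Proof.
elim: s => [|a s IH] hs; first by rewrite big_nil dvd1p.
rewrite big_cons; set Q := \prod_(z <- s) _ in IH *.
rewrite derivM derivXsubC mul1r [X in _ %| X]mulrDl; apply: dvdp_add.
  by rewrite mulrC dvdp_mul // dvdp_XsubCl hs ?mem_head.
rewrite -mulrA dvdp_mul2l ?polyXsubC_eq0 //.
by apply: IH => z zs; rewrite hs // in_cons zs orbT.
Qed.

Lemma size_subC p w : (1 < size p)%N -> size (p - w%:P) = size p.
Proof. by move=> sp; rewrite size_polyDl // size_polyN (leq_ltn_trans (size_polyC_leq1 _)). Qed.

Lemma lead_coef_subC p w : (1 < size p)%N -> lead_coef (p - w%:P) = lead_coef p.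
Proof. by move=> sp; rewrite lead_coefDl // size_polyN (leq_ltn_trans (size_polyC_leq1 _)). Qed.

Lemma size_sub_scale p q : (0 < size p)%N -> size q = size p ->
  (size (q - (lead_coef q / lead_coef p) *: p)%R <= (size p).-1)%N.
Proof.
move=> sp sq; set b := lead_coef q / lead_coef p.
have p0 : lead_coef p != 0 by rewrite lead_coef_eq0 -size_poly_gt0.
have -> : q - b *: p =
    (q - q`_(size p).-1 *: 'X^((size p).-1)) - b *: (p - p`_(size p).-1 *: 'X^((size p).-1)).
  rewrite scalerBr scalerA -[in q`__]sq -!lead_coefE divfK //; ring.
rewrite (leq_trans (size_polyD _ _)) // size_polyN geq_max.
by rewrite (leq_trans (size_scale_leq _ _)) size_sub_lead ?sq ?prednK.
Qed.

Lemma fibre_eq p w s : p - w%:P = lead_coef p *: \prod_(z <- s) ('X - z%:P) ->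
  {in s, forall z, p.[z] = w}.
Proof.
move=> es z zs; apply/eqP; rewrite -subr_eq0; have := congr1 (horner^~ z) es.
rewrite hornerD hornerN hornerC => ->; rewrite hornerZ mulf_eq0.
by rewrite -rootE root_prod_XsubC zs orbT.
Qed.

Lemma fibreP p w : (1 < size p)%N -> exists s, size s = (size p).-1 /\
  p - w%:P = lead_coef p *: \prod_(z <- s) ('X - z%:P).
Proof.
move=> sp; have [s es] := closed_field_poly_normal (p - w%:P).
have p0 : lead_coef p != 0 by rewrite lead_coef_eq0 -size_poly_gt0 (ltn_trans _ sp).
rewrite lead_coef_subC // in es; exists s; split => //.
by rewrite -(size_subC w sp) es size_scale // size_prod_XsubC.
Qed.

(** Write [q = b p + h] with [h] of smaller degree: [p] is constant on a fibre and the sum of [h] is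
    the same on all fibres, so [k] can be taken from the fibre above 0. *)
Lemma fibre_sum p q : (1 < size p)%N -> size q = size p ->
  exists k, forall w s, size s = (size p).-1 ->
    p - w%:P = lead_coef p *: \prod_(z <- s) ('X - z%:P) ->
    \sum_(z <- s) q.[z] = (lead_coef q / lead_coef p * w + k) *+ (size p).-1.
Proof.
move=> sp sq; set b := lead_coef q / lead_coef p.
have p0 : lead_coef p != 0 by rewrite lead_coef_eq0 -size_poly_gt0 (ltn_trans _ sp).
have n0 : (size p).-1%:R != 0 :> C by rewrite pnatr_eq0 -lt0n -ltnS prednK // ltnW.
pose h := q - b *: p.
have sh : (size h <= (size p).-1)%N by apply: size_sub_scale; rewrite // ltnW.
have [s0 [ss0 es0]] := fibreP 0 sp.
exists ((\sum_(z <- s0) h.[z]) / (size p).-1%:R) => w s ss es.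
have eqs : \prod_(z <- s) ('X - z%:P) = \prod_(z <- s0) ('X - z%:P) + (- w / lead_coef p)%:P.
  apply: (scalerI p0); rewrite scalerDr -es -es0 polyC0 subr0 -mul_polyC -polyCM mulrCA divff //.
  by rewrite mulr1 polyCN.
rewrite mulrnDl -[X in _ + X]mulr_natr divfK // -(fibre_sum_const _ _ eqs) ?ss ?ss0 //.
have -> : (b * w) *+ (size p).-1 = \sum_(z <- s) b * p.[z].
  rewrite -ss (eq_big_seq (fun=> b * w)) => [|z /(fibre_eq es) -> //].
  by rewrite big_const_seq count_predT iter_addr_0.
by rewrite -big_split /=; apply: eq_bigr => z _; rewrite /h hornerD hornerN hornerZ addrC subrK.
Qed.

Lemma norm_mean_le s (F : C -> C) r : (0 < size s)%N ->
  {in s, forall z, `|F z| <= r} -> `|(\sum_(z <- s) F z) / (size s)%:R| <= r.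
Proof.
move=> s0 hs; rewrite normrM normfV normr_nat ler_pdivrMr ?ltr0n //.
apply: le_trans (ler_norm_sum _ _ _) _; rewrite big_seq.
apply: le_trans (ler_sum _ hs) _; rewrite -big_seq big_const_seq count_predT iter_addr_0.
by rewrite mulr_natr.
Qed.

(** Equality case of the triangle inequality; division by [v] reduces it to terms of norm at most 1
    whose sum is their number. *)
Lemma norm_mean_eq s (F : C -> C) r v : (0 < size s)%N -> `|v| = r ->
  {in s, forall z, `|F z| <= r} -> \sum_(z <- s) F z = v *+ size s ->
  {in s, forall z, F z = v}.
Proof.
move=> s0 vr hs e; have [v0|v0] := eqVneq v 0.
  by move=> z zs; have := hs z zs; rewrite -vr v0 normr0 normr_le0 => /eqP.
have r0 : r != 0 by rewrite -vr normr_eq0.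
pose x0 := head 0 s; pose G (i : 'I_(size s)) := F (nth x0 s i) / v.
have sumG : \sum_i G i = \sum_(i < size s) 1.
  rewrite -mulr_suml sumr_const card_ord -(big_mkord xpredT (fun i => F (nth x0 s i))).
  by rewrite -(big_nth x0 xpredT F) e -mulr_natr mulrAC divff // mul1r.
have G1 := normC_sum_upper (P := xpredT) _ sumG.
move=> z zs; have := G1 _ (Ordinal (etrans (index_mem z s) zs)) isT.
rewrite /G /= nth_index // => e1; rewrite -[F z](divfK v0) e1 ?mul1r // => i _.
rewrite normrM normfV vr ler_pdivrMr ?mul1r ?hs ?mem_nth //.
by rewrite -vr normr_gt0.
Qed.

(** * Smallest discs and completely invariant sets *)

Section SmallestDisc.
Variables (J : C -> Prop) (c r : C).
Hypothesis in_disc : forall w, J w -> `|w - c| <= r.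
Hypothesis disc_min : forall c' r' : C, (forall w, J w -> `|w - c'| <= r') -> r <= r'.
Hypothesis r_gt0 : 0 < r.

(** By the parallelogram law, two discs of radius [r] containing J confine J to a disc about the
    midpoint of the centres, with squared radius [r ^+ 2 - e]. *)
Lemma smallest_disc_centre_unique c' : (forall w, J w -> `|w - c'| <= r) -> c' = c.
Proof.
move=> in_disc'; pose m := (c + c') / 2%:R; pose e := `|c - c'| ^+ 2 / 4%:R.
have rr : r \is Num.real by rewrite realE ltW.
have e0 : 0 <= e by rewrite divr_ge0 ?exprn_ge0.
have par w : `|w - m| ^+ 2 = (`|w - c| ^+ 2 + `|w - c'| ^+ 2) / 2%:R - e.
  by rewrite /e /m !normCK !rmorphB /= !rmorphM /= rmorphD fmorphV /= rmorph_nat; field.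
have bnd w : J w -> `|w - m| ^+ 2 <= r ^+ 2 - e.
  move=> Jw; rewrite par lerD2r ler_pdivrMr ?ltr0n // mulr_natr mulr2n.
  by rewrite lerD // lerXn2r ?nnegrE ?(ltW r_gt0) // ?in_disc ?in_disc'.
have [le|] := boolP (0 <= r ^+ 2 - e); last first.
  have re : r ^+ 2 - e \is Num.real by rewrite rpredB ?rpredX ?(ger0_real e0).
  rewrite -real_ltNge // => lt.
  (* Here J has no point, so the radius 0 is admissible in [disc_min]. *)
  have : r <= 0; last by move/(lt_le_trans r_gt0); rewrite ltxx.
  apply: (disc_min (c' := m)) => w Jw.
  have := le_lt_trans (exprn_ge0 2 (normr_ge0 (w - m))) (le_lt_trans (bnd w Jw) lt).
  by rewrite ltxx.
have : r <= sqrtC (r ^+ 2 - e).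
  apply: (disc_min (c' := m)) => w Jw.
  by rewrite -(@ler_pXn2r _ 2) ?nnegrE ?sqrtC_ge0 // sqrtCK bnd.
rewrite -(@ler_pXn2r _ 2) ?nnegrE ?sqrtC_ge0 ?(ltW r_gt0) // sqrtCK.
rewrite lerBrDr gerDl => e0'; have /eqP : e = 0 by apply/le_anti; rewrite e0 e0'.
rewrite mulf_eq0 invr_eq0 pnatr_eq0 orbF expf_eq0 /= normr_eq0 subr_eq0.
by move/eqP.
Qed.

Lemma fibre_mean_bound p q : (1 < size p)%N -> size q = size p ->
  (forall z, J p.[z] <-> J z) -> (forall z, J z -> J q.[z]) ->
  exists k, (forall w s, size s = (size p).-1 ->
      p - w%:P = lead_coef p *: \prod_(z <- s) ('X - z%:P) ->
      \sum_(z <- s) q.[z] = (lead_coef q / lead_coef p * w + k) *+ (size p).-1) /\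
    forall w, J w -> `|lead_coef q / lead_coef p * w + k - c| <= r.
Proof.
move=> sp sq Jp Jq; have [k hk] := fibre_sum sp sq; exists k; split => // w Jw.
have [s [ss es]] := fibreP w sp; have hs := fibre_eq es.
have s0 : (0 < size s)%N by rewrite ss -ltnS prednK // ltnW.
have := @norm_mean_le s (fun z => q.[z] - c) r s0.
rewrite sumrB big_const_seq count_predT iter_addr_0 (hk w) // -ss -mulrnBl.
rewrite -[X in X / _]mulr_natr mulfK ?pnatr_eq0 -?lt0n //; apply => z zs.
by apply/in_disc/Jq/Jp; rewrite hs.
Qed.

(** Read backwards, the affine map of the means, of slope [b], puts J into a disc of radius
    [r / |b|]; minimality of [r] then gives [|b| <= 1]. *)
Lemma lead_coef_norm_le p q : (1 < size p)%N -> size q = size p ->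
  (forall z, J p.[z] <-> J z) -> (forall z, J z -> J q.[z]) ->
  `|lead_coef q| <= `|lead_coef p|.
Proof.
move=> sp sq Jp Jq; have [k [_ hk]] := fibre_mean_bound sp sq Jp Jq.
have p0 : lead_coef p != 0 by rewrite lead_coef_eq0 -size_poly_gt0 (ltn_trans _ sp).
have q0 : lead_coef q != 0 by rewrite lead_coef_eq0 -size_poly_gt0 sq (ltn_trans _ sp).
set b := lead_coef q / lead_coef p in hk.
have b0 : b != 0 by rewrite mulf_neq0 ?invr_eq0.
have : r <= r / `|b|.
  apply: (disc_min (c' := (c - k) / b)) => w Jw.
  rewrite ler_pdivlMr ?normr_gt0 // -normrM mulrBl divfK //.
  by rewrite mulrC opprB addrA hk.
rewrite ler_pdivlMr ?normr_gt0 // -ler_pdivlMl // mulVf ?gt_eqF //.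
by rewrite normrM normfV ler_pdivrMr ?normr_gt0 // mul1r.
Qed.

Lemma same_invariant_set p q w0 w1 : (1 < size p)%N -> size q = size p ->
  (forall z, J p.[z] <-> J z) -> (forall z, J q.[z] <-> J z) ->
  J w0 -> J w1 -> w0 != w1 -> `|w0 - c| = r -> `|w1 - c| = r ->
  exists2 u, `|u| = 1 & q - c%:P = u *: (p - c%:P).
Proof.
move=> sp sq Jp Jq J0 J1 w01 r0 r1.
have p0 : lead_coef p != 0 by rewrite lead_coef_eq0 -size_poly_gt0 (ltn_trans _ sp).
have [k [hk bk]] := fibre_mean_bound sp sq Jp (fun z => (Jq z).2).
set u := lead_coef q / lead_coef p in hk bk.
have u1 : `|u| = 1.
  suff eqn : `|lead_coef q| = `|lead_coef p| by rewrite normrM normfV eqn divff ?normr_eq0.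
  have sq1 : (1 < size q)%N by rewrite sq.
  apply/le_anti; rewrite (lead_coef_norm_le sp sq Jp (fun z => (Jq z).2)).
  by rewrite (lead_coef_norm_le sq1 (esym sq) Jq (fun z => (Jp z).2)).
have u0 : u != 0 by rewrite -normr_eq0 u1 oner_eq0.
(* J lies in the disc of radius [r] about the preimage of [c] under the map of the means, so this
   preimage is [c] again. *)
have ck : (c - k) / u = c.
  apply: smallest_disc_centre_unique => w Jw.
  rewrite -[`|_|]mulr1 -u1 -normrM mulrBl divfK // mulrC opprB addrA; exact: bk.
have {}ck : k = c - u * c by rewrite -[in u * c]ck mulrC divfK // opprB addrC subrK.
exists u => //; apply/eqP; rewrite -subr_eq0; set h := _ - _.
(* For [w] on the boundary circle the mean of [q - c] has the maximal norm [r], so all its terms are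
   equal. *)
have vanish w s : J w -> `|w - c| = r -> size s = (size p).-1 ->
    p - w%:P = lead_coef p *: \prod_(z <- s) ('X - z%:P) ->
    {in s, forall z, root h z}.
  move=> Jw wr ss es; have hs := fibre_eq es.
  have s0 : (0 < size s)%N by rewrite ss -ltnS prednK // ltnW.
  have := @norm_mean_eq s (fun z => q.[z] - c) r (u * (w - c)) s0.
  rewrite normrM u1 mul1r wr sumrB big_const_seq count_predT iter_addr_0 (hk w) // -ss.
  rewrite -mulrnBl ck => /(_ erefl) H z zs.
  rewrite rootE /h !(hornerD, hornerN, hornerZ, hornerC) hs // H ?subrr // => [y ys|].
    by apply/in_disc/Jq/Jp; rewrite hs.
  by congr (_ *+ _); ring.
(* As [h] vanishes on the fibres over [w0] and [w1], the product
   [(p - w0) (p - w1)] divides [p' h], whose degree is too small. *)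
have [s0 [ss0 es0]] := fibreP w0 sp; have [s1 [ss1 es1]] := fibreP w1 sp.
have d0 := dvdp_prod_deriv (vanish _ _ J0 r0 ss0 es0).
have d1 := dvdp_prod_deriv (vanish _ _ J1 r1 ss1 es1).
have dv s w : p - w%:P = lead_coef p *: \prod_(z <- s) ('X - z%:P) ->
   \prod_(z <- s) ('X - z%:P) %| (\prod_(z <- s) ('X - z%:P))^`() * h -> p - w%:P %| p^`() * h.
  move=> es d; have -> : p^`() = (p - w%:P)^`() by rewrite derivB derivC subr0.
  by rewrite es derivZ -scalerAl dvdpZl // dvdpZr.
have cop : coprimep (p - w0%:P) (p - w1%:P).
  apply/Bezout_eq1_coprimepP; exists ((w1 - w0)^-1%:P, - (w1 - w0)^-1%:P) => /=.
  transitivity ((w1 - w0)^-1%:P * (w1%:P - w0%:P)); first by ring.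
  rewrite -polyCB -polyCM mulVf //.
  by rewrite subr_eq0 eq_sym.
have := Gauss_dvdp (p^`() * h) cop; rewrite (dv _ _ es0 d0) (dv _ _ es1 d1) => dd.
apply/negPn/negP => h0.
have pn0 : p != 0 by rewrite -lead_coef_eq0.
have sp' := lt_size_deriv pn0.
have p'0 : p^`() != 0.
  apply: contraNneq p0 => /(congr1 (fun r : {poly C} => r`_(size p).-2)).
  rewrite coef0 coef_deriv => /eqP; rewrite mulrn_eq0 lead_coefE /=.
  by case: (size p) sp => [|[|n]].
have sw w : size (p - w%:P) = size p by rewrite size_subC.
have pw w : p - w%:P != 0 by rewrite -size_poly_gt0 sw ltnW.
have := dvdp_leq (mulf_neq0 p'0 h0) dd; rewrite !size_mul // !sw.
have : (size h <= (size p).-1)%N.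
  rewrite /h /u -(lead_coef_subC c sp) -(@lead_coef_subC q c) ?sq // -(size_subC c sp).
  by rewrite size_sub_scale ?size_subC ?sq // ltnW.
by move: sp sp'; move: (size p) (size h) (size p^`()); clear; lia.
Qed.

End SmallestDisc.

(** * Affine polynomials and coefficients of compositions *)

Lemma size_affine a b : a != 0 -> size (a *: 'X + b%:P) = 2.
Proof.
move=> a0; rewrite size_polyDl size_scale ?size_polyX //.
exact: leq_ltn_trans (size_polyC_leq1 b) _.
Qed.

Lemma affineP p : size p = 2 -> exists a b, a != 0 /\ p = a *: 'X + b%:P.
Proof.
move=> sp; exists p`_1, p`_0; split.
  by have := lead_coef_eq0 p; rewrite lead_coefE -size_poly_eq0 sp => ->.
apply/polyP => i; rewrite coefD coefZ coefX coefC.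
case: i => [|[|i]] /=; rewrite ?mulr0 ?mulr1 ?add0r ?addr0 //.
by rewrite nth_default ?sp.
Qed.

Lemma affine_comp p a b : (a *: 'X + b%:P) \Po p = a *: p + b%:P.
Proof. by rewrite comp_polyD comp_polyZ comp_polyX comp_polyC. Qed.

Lemma affine_invP p : size p = 2 -> exists q, [/\ size q = 2, p \Po q = 'X & q \Po p = 'X].
Proof.
move=> /affineP [a [b [a0 ->]]]; exists (a^-1 *: 'X + (- b / a)%:P).
rewrite size_affine ?invr_eq0 // !affine_comp !scalerDr !scalerA mulVf // divff // !scale1r.
rewrite -!mul_polyC -!polyCM; split=> //; rewrite -addrA -polyCD ?[_ * (_ / _)]mulrC ?divfK //.
  by rewrite addNr addr0.
by rewrite mulrC mulNr subrr addr0.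
Qed.

Lemma comp_poly_cancel p P Q : (1 < size p)%N -> P \Po p = Q \Po p -> P = Q.
Proof.
move=> sp e; apply/eqP; rewrite -subr_eq0 -(comp_poly_eq0 _ sp) comp_polyB e subrr //.
Qed.

Lemma coef_affine_exp a b (i : nat) : let l := a *: 'X + b%:P in
  [/\ (size (l ^+ i)%R <= i.+1)%N, (l ^+ i)`_i = a ^+ i & (l ^+ i.+1)`_i = a ^+ i * b *+ i.+1].
Proof.
move=> l; have sl : (size l <= 2)%N.
  rewrite (leq_trans (size_polyD _ _)) // geq_max (leq_trans (size_scale_leq _ _)) ?size_polyX //.
  exact: leq_trans (size_polyC_leq1 b) _.
have l1 : l`_1 = a by rewrite coefD coefZ coefX coefC mulr1 addr0.
have l0 : l`_0 = b by rewrite coefD coefZ coefX coefC mulr0 add0r.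
have s j : (size (l ^+ j)%R <= j.+1)%N by have := @size_exp_top l 1 j sl; rewrite mul1n.
have t j : (l ^+ j)`_j = a ^+ j by have := @coefX_top l 1 j sl; rewrite mul1n l1.
split=> //; elim: i => [|i IH]; first by rewrite expr1 expr0 mul1r.
rewrite exprS {1}/l mulrDl coefD -scalerAl coefZ coefXM /= IH coefCM t.
rewrite -mulrnAr mulrA -exprS mulrnAr [in RHS]mulrSr; congr (_ + _); exact: mulrC.
Qed.

(** This coefficient detects translations: for [p] of degree [k.+1] with vanishing subleading
    coefficient and [a] nonzero, it is zero only if [b = 0]. *)
Lemma coef_comp_affine p a b (k : nat) : (size p <= k.+2)%N ->
  (p \Po (a *: 'X + b%:P))`_k = a ^+ k * (p`_k + p`_k.+1 * b *+ k.+1).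
Proof.
move=> sp; have -> : p = \poly_(i < k.+2) p`_i.
  by apply/polyP => i; rewrite coef_poly; case: ltnP => // le; rewrite nth_default // (leq_trans sp).
rewrite poly_def raddf_sum /= coef_sum !big_ord_recr /= big1 => [|i _].
  rewrite add0r !comp_polyZ !comp_Xn_poly !coefZ.
  have [_ -> ->] := coef_affine_exp a b k.
  rewrite !coefD !coefZ !coefXn eqxx !coef_sum.
  rewrite big1 => [|i _]; last by rewrite coefZ coefXn gtn_eqF ?mulr0.
  rewrite big1 => [|i _]; last by rewrite coefZ coefXn gtn_eqF ?mulr0 // ltnW // ltnS.
  rewrite !eqxx (gtn_eqF (ltnSn k)) (ltn_eqF (ltnSn k)) /=.
  rewrite -!mulrnAr; ring.
rewrite comp_polyZ comp_Xn_poly coefZ [X in _ * X]nth_default ?mulr0 //.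
by have [s _ _] := coef_affine_exp a b i; rewrite /= (leq_trans s).
Qed.

Lemma coef_comp_scale p a (k : nat) : (p \Po (a *: 'X))`_k = a ^+ k * p`_k.
Proof.
rewrite comp_polyE coef_sum; have [lt|le] := ltnP k (size p).
  rewrite (bigD1 (Ordinal lt)) //= big1 => [|i /eqP ne].
    by rewrite exprZn !coefZ coefXn eqxx mulr1 mulrC addr0.
  rewrite exprZn !coefZ coefXn; case: eqP => [e|_]; last by rewrite !mulr0.
  by case: ne; apply/val_inj.
rewrite [p`__]nth_default // mulr0 big1 // => i _.
by rewrite exprZn !coefZ coefXn gtn_eqF ?mulr0 // (leq_trans _ le).
Qed.

(** * Iterates and their affine equivalence *)

Local Notation it f n := (iter n (fun q => f \Po q) 'X).

Lemma iter_compD p (m n : nat) : it p (m + n) = it p m \Po it p n.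
Proof. by elim: m => [|m IH]; rewrite ?comp_polyX //= IH comp_polyA. Qed.

Lemma size_iter_comp p (d n : nat) : size p = d.+1 -> (0 < d)%N -> size (it p n) = (d ^ n).+1.
Proof.
move=> sp d0; elim: n => [|n IH]; first by rewrite size_polyX.
have := size_comp_poly p (it p n); rewrite [it p n.+1]/= IH sp /= -expnS.
by case: (size _) => [|k] /= e; [move: e (expn_gt0 d n.+1); rewrite d0 => <-|rewrite e].
Qed.

Lemma horner_iter_comp p (n : nat) z : (it p n).[z] = iter n (horner p) z.
Proof. by elim: n => [|n IH]; rewrite ?hornerX //= horner_comp IH. Qed.

(** The algebraic form of [schwarz_equiv]: composing with [L] on the left leaves the Schwarzian
    unchanged, composing with [M] on the right pulls it back. *)
Definition affine_equiv p q :=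
  exists L M : {poly C}, [/\ size L = 2, size M = 2 & p = L \Po (q \Po M)].

Lemma iter_affine_descend p q L M (d m n : nat) : (1 < d)%N ->
  size p = d.+1 -> size q = d.+1 -> size L = 2 -> size M = 2 -> (0 < n <= m)%N ->
  it p m = L \Po (it q m \Po M) ->
  exists2 L' : {poly C}, size L' = 2 & it p n = L' \Po (it q n \Po M).
Proof.
move=> d1 sp sq sL sM /andP[n0 nm]; have d0 := ltnW d1.
have dn j : exists k, (d ^ j = k.+1)%N.
  by exists (d ^ j).-1; rewrite prednK // expn_gt0 d0.
rewrite -(subnK nm) !iter_compD -(comp_polyA (it q (m - n))) (comp_polyA L) => e.
have [k ek] := dn n; have [l el] := dn (m - n)%N.
have := @comp_poly_left_unique (it p (m - n)) (L \Po it q (m - n)) (it p n) (it q n \Po M) k l.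
rewrite size_comp_poly2 // !(size_iter_comp _ sp) // !(size_iter_comp _ sq) // ek el.
have -> : size (L \Po it q (m - n)) = l.+2.
  have := size_comp_poly L (it q (m - n)); rewrite sL (size_iter_comp _ sq) // el /= mul1n.
  by case: (size _) => // s /= ->.
move=> /(_ erefl erefl erefl erefl e) [a [b [a0 eq]]].
have [L' [sL' _ L'K]] := affine_invP (size_affine b a0).
by exists L' => //; rewrite eq -affine_comp comp_polyA L'K comp_polyX.
Qed.

Lemma eq_lead_monomial p (d : nat) : size p = d.+1 -> (forall i, (i < d)%N -> p`_i = 0) ->
  p = lead_coef p *: 'X^d.
Proof.
move=> sp h; apply/polyP => i; rewrite coefZ coefXn lead_coefE sp /=.
case: (ltngtP i d) => [/h ->|lt|->]; rewrite ?mulr0 ?mulr1 //.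
by rewrite nth_default ?sp.
Qed.

(** Post-composition can absorb the constant [b] in the first iterate. In the second it also
    produces the term d a (a X^d)^(d-1) b, which cannot be absorbed. *)
Lemma coef_iter2_monomial a b (d : nat) : (1 < d)%N ->
  (it (a *: 'X^d + b%:P)%R 2)`_(d * d.-1) = a ^+ d * b *+ d.
Proof.
case: d => [|[|d]] // _; rewrite [it _ 2]/= comp_polyXr; set l2 := _ + _.
have sl : (size (a *: 'X + b%:P)%R <= 2)%N.
  rewrite (leq_trans (size_polyD _ _)) // geq_max (leq_trans (size_scale_leq _ _)) ?size_polyX //.
  exact: leq_trans (size_polyC_leq1 b) _.
have e : l2 = (a *: 'X + b%:P) \Po 'X^(d.+2) by rewrite affine_comp.
rewrite [X in _ \Po X]e comp_polyA coef_comp_poly_Xn // dvdn_mulr // mulKn //.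
rewrite /l2 coef_comp_affine ?(leq_trans (size_polyD _ _)) ?geq_max
  ?(leq_trans (size_scale_leq _ _)) ?size_polyXn ?(leq_trans (size_polyC_leq1 b)) //.
rewrite !coefD !coefZ !coefXn !coefC eqxx ltn_eqF //= mulr0 !addr0 add0r mulr1.
by rewrite [in RHS]exprSr mulrnAr mulrA.
Qed.

Section CentredIterates.
Variables (f g : {poly C}) (d : nat).
Hypotheses (d_gt1 : (1 < d)%N) (sf : size f = d.+1) (sg : size g = d.+1).
Hypotheses (cf : f`_d.-1 = 0) (cg : g`_d.-1 = 0).
Hypothesis equiv_it : forall n, (0 < n)%N -> affine_equiv (it f n) (it g n).

(* Up to post-composition, the homothety [a] carries [g^n] to [f^n]. *)
Let S n a := a != 0 /\ exists c e, c != 0 /\ it f n = c *: (it g n \Po (a *: 'X)) + e%:P.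

Let d_gt0 : (0 < d)%N. Proof. exact: ltnW. Qed.

Let pd_gt0 : (0 < d.-1)%N. Proof. by rewrite -ltnS prednK. Qed.

Let fd0 : f`_d != 0.
Proof. by have := lead_coef_eq0 f; rewrite lead_coefE -size_poly_eq0 sf => ->. Qed.

Let gd0 : g`_d != 0.
Proof. by have := lead_coef_eq0 g; rewrite lead_coefE -size_poly_eq0 sg => ->. Qed.

Let S_descend m n a : (0 < n <= m)%N -> S m a -> S n a.
Proof.
move=> nm [a0 [c [e [c0 eq]]]]; split=> //.
have sM : size (a *: 'X) = 2 by have := size_affine 0 a0; rewrite addr0.
rewrite -affine_comp in eq.
have [L sL eL] := iter_affine_descend d_gt1 sf sg (size_affine e c0) sM nm eq.
by have [c' [e' [c0' eL']]] := affineP sL; exists c', e'; rewrite eL eL' affine_comp.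
Qed.

Let S_ex n : (0 < n)%N -> exists a, S n a.
Proof.
move=> n0; have [L [M [sL sM e]]] := equiv_it n0.
have n1 : (0 < 1 <= n)%N by rewrite n0.
have [L' sL' e1] := iter_affine_descend d_gt1 sf sg sL sM n1 e.
move: sM e e1 => /affineP [a [b [a0 ->]]] e /=; rewrite !comp_polyXr => e1.
(* At the first iterate both subleading coefficients vanish, which excludes a translation in [M];
   the same [M] serves for [n]. *)
suff b0 : b = 0.
  exists a; split=> //; have [c [e' [c0 eL]]] := affineP sL; exists c, e'; split => //.
  by rewrite e eL affine_comp b0 addr0.
have [c [e' [c0 eL]]] := affineP sL'; move: e1; rewrite eL affine_comp.
move/(congr1 (fun p : {poly C} => p`_d.-1)); rewrite cf coefD coefZ coefC.
have d1 : d = d.-1.+1 by rewrite prednK // ltnW.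
have -> : (d.-1 == 0)%N = false by move: d_gt1; case: d => [|[|]].
rewrite addr0 coef_comp_affine ?sg -?d1 // cg add0r => /esym/eqP.
rewrite !mulf_eq0 (negPf c0) expf_eq0 (negPf a0) andbF /= mulrn_eq0 mulf_eq0 (negPf gd0) /=.
by rewrite eqn0Ngt (ltnW d_gt1) /= => /eqP.
Qed.

(** Two consecutive iterates with the same [a] have the common right factor [G]. Cancelling it
    leaves [f \Po (c *: 'X + e%:P) = c' *: g + e'%:P], and the vanishing subleading coefficients
    force [e = 0]. *)
Let step n a c e c' e' : (0 < n)%N -> a != 0 -> c != 0 ->
  it f n = c *: (it g n \Po (a *: 'X)) + e%:P ->
  it f n.+1 = c' *: (it g n.+1 \Po (a *: 'X)) + e'%:P ->
  e = 0 /\ f \Po (c *: 'X) = c' *: g + e'%:P.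
Proof.
move=> n0 a0 c0 en en1; set G := it g n \Po (a *: 'X) in en.
have sG : (1 < size G)%N.
  rewrite size_comp_poly2 ?(size_iter_comp _ sg) ?ltnS ?expn_gt0 ?(ltnW d_gt1) //.
  by have := size_affine 0 a0; rewrite addr0.
have eq : f \Po (c *: 'X + e%:P) = c' *: g + e'%:P.
  apply: (comp_poly_cancel sG); rewrite -comp_polyA affine_comp -en comp_polyD comp_polyZ comp_polyC.
  by rewrite /G comp_polyA.
have d1 : d = d.-1.+1 by rewrite prednK // ltnW.
suff e0 : e = 0 by split => //; rewrite -eq e0 addr0.
move/(congr1 (fun p : {poly C} => p`_d.-1)): eq.
rewrite coef_comp_affine ?sf -?d1 // cf add0r coefD coefZ cg mulr0 add0r coefC.
have -> : (d.-1 == 0)%N = false by move: d_gt1; case: d => [|[|]].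
move/eqP; rewrite mulf_eq0 expf_eq0 (negPf c0) andbF /= mulrn_eq0 mulf_eq0 (negPf fd0) /=.
by rewrite eqn0Ngt (ltnW d_gt1) /= => /eqP.
Qed.

Let common_scale : (exists2 k, (k < d)%N & g`_k != 0) -> exists a, forall n, (0 < n)%N -> S n a.
Proof.
move=> hk.
(* A nonzero coefficient strictly between the constant and the top one is needed, because the
   constant term is free in [S]. If [g] has none, it is a monomial plus a nonzero constant, and its
   second iterate has one. *)
have [m [k [m0 k0 km gk]]] : exists m k,
    [/\ (0 < m)%N, (0 < k)%N, (k < d ^ m)%N & (it g m)`_k != 0].
  have [[k /andP[k0 kd] gk]|no] := pselect (exists2 k, (0 < k < d)%N & g`_k != 0).
    by exists 1, k; rewrite expn1 /= comp_polyXr.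
  have g0 i : (0 < i < d)%N -> g`_i = 0.
    by move=> i0; apply/eqP/negPn/negP => gi; apply: no; exists i.
  have b0 : g`_0 != 0.
    by have [[|k] kd gk] := hk => //; rewrite g0 ?eqxx in gk.
  have eg : g = lead_coef g *: 'X^d + (g`_0)%:P.
    rewrite -[LHS](subrK (g`_0)%:P); congr (_ + _).
    rewrite -[in RHS](lead_coef_subC g`_0); last by rewrite sg ltnS ltnW.
    apply: eq_lead_monomial => [|i id].
      by rewrite size_subC ?sg // ltnS ltnW.
    by rewrite coefB coefC; case: i id => [|i] id; rewrite ?subrr //= subr0 g0.
  exists 2, (d * d.-1)%N; split => //.
  - by rewrite muln_gt0 d_gt0 pd_gt0.
  - by rewrite expnS expn1 ltn_pmul2l // prednK.
  rewrite eg coef_iter2_monomial // mulrn_eq0 mulf_eq0 (negPf b0) expf_eq0 lead_coef_eq0.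
  by rewrite -size_poly_eq0 sg andbF !orbF eqn0Ngt d_gt0.
have [a0 Sa0] := S_ex m0.
pose D := (d ^ m)%N; pose K := (it f m)`_D * (it g m)`_k / ((it g m)`_D * (it f m)`_k).
have gD : (it g m)`_D != 0.
  have := lead_coef_eq0 (it g m); rewrite lead_coefE -size_poly_eq0 (size_iter_comp _ sg) //=.
  by move=> ->.
have D0 : (0 < D)%N by rewrite (leq_ltn_trans _ km).
(* The quotient of the coefficients at [D] and [k] eliminates [c], and [e] reaches neither of
   them. *)
have SK a : S m a -> a ^+ (D - k) = K.
  move=> [an0 [c [e [c0 eq]]]]; rewrite /K eq !coefD !coefZ !coefC !coef_comp_scale.
  have -> : a ^+ D = a ^+ (D - k) * a ^+ k by rewrite -exprD subnK // ltnW.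
  rewrite !gtn_eqF // !addr0.
  by field; rewrite gk gD c0 expf_neq0.
have [s sP] : exists s : seq C, forall a, S m a -> a \in s.
  have [s es] := closed_field_poly_normal ('X^(D - k) - K%:P).
  exists s => a /SK eK; rewrite -root_prod_XsubC -(rootZ _ _ (a := lead_coef ('X^(D - k) - K%:P))).
    by rewrite -es rootE hornerD hornerN hornerC hornerXn eK subrr.
  by rewrite lead_coef_eq0 -size_poly_eq0 size_XnsubC // subn_gt0.
apply: contrapT => /forallNP no.
(* The sets [S n] are nonempty and decreasing, and [S m] is finite. *)
have /boolp.choice[N hN] : forall a, exists n, (0 < n)%N /\ ~ S n a.
  move=> a; apply: contrapT => /forallNP h.
  by apply: (no a) => n n0; apply: contrapT => nS; apply: (h n).
pose M := maxn m (\max_(a <- s) N a).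
have M0 : (0 < M)%N by rewrite (leq_trans m0) ?leq_maxl.
have [a Sa] := S_ex M0.
have as_ : a \in s by apply/sP/(S_descend _ Sa); rewrite m0 leq_maxl.
have [Na0 nSa] := hN a; apply: nSa; apply: (S_descend _ Sa); rewrite Na0 /=.
by rewrite leq_max (big_rem a) //= leq_maxl orbT.
Qed.

Lemma centred_iterates_conj : exists a u j, [/\ a != 0, (0 < j)%N, u ^+ j = 1,
  g \Po (u *: 'X) = u ^+ d *: g & a *: (f \Po (a^-1 *: 'X)) = u *: g].
Proof.
have [hk|no] := pselect (exists2 k, (k < d)%N & g`_k != 0).
  have [a Sa] := common_scale hk; have [a0 [c1 [e1 [c10 E1]]]] := Sa 1%N isT.
  (* The second iterate removes the constant [e1] from the first relation, the third removes [e2]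
     from the second. *)
  have [_ [c2 [e2 [c20 E2]]]] := Sa 2%N isT; have [_ [c3 [e3 [c30 E3]]]] := Sa 3%N isT.
  have [e10 F1] := @step 1%N _ _ _ _ _ isT a0 c10 E1 E2.
  have [e20 _] := @step 2%N _ _ _ _ _ isT a0 c20 E2 E3.
  move: E1 F1; rewrite e10 e20 !addr0 /= !comp_polyXr => E1 F1.
  have aX : (a^-1 *: 'X) \Po (a *: 'X) = 'X :> {poly C}.
    by rewrite comp_polyZ comp_polyX scalerA mulVf // scale1r.
  have Xa : (a *: 'X) \Po (a^-1 *: 'X) = 'X :> {poly C}.
    by rewrite comp_polyZ comp_polyX scalerA divff // scale1r.
  (* Substituting [f = c1 *: (g \Po (a *: 'X))] into [f \Po (c1 *: 'X) = c2 *: g] shows that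
     [g \Po (u *: 'X)] is proportional to [g]. Hence [u ^+ i] is the same for all [i] in the support
     of [g]. *)
  pose u := a * c1.
  have gu i : c1 * (u ^+ i * g`_i) = c2 * g`_i.
    have := congr1 (fun p : {poly C} => p`_i) F1.
    rewrite E1 comp_polyZ -comp_polyA comp_polyZ comp_polyX scalerA !coefZ => <-.
    by rewrite coef_comp_scale.
  have ud : c1 * u ^+ d = c2 by apply: (mulIf gd0); rewrite -gu mulrA.
  have [k kd gk] := hk.
  exists a, u, (d - k)%N; split=> //; first by rewrite subn_gt0.
  - have uk : c1 * u ^+ k = c2 by apply: (mulIf gk); rewrite -gu mulrA.
    have u0 : u ^+ k != 0 by rewrite expf_neq0 // mulf_neq0.
    apply: (mulIf u0); rewrite -exprD subnK ?(ltnW kd) // mul1r; apply: (mulfI c10).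
    by rewrite ud uk.
  - apply/polyP => i; rewrite coef_comp_scale coefZ; apply: (mulfI c10).
    by rewrite gu mulrA ud.
  - by rewrite E1 comp_polyZ -comp_polyA Xa comp_polyXr scalerA.
have g0 i : (i < d)%N -> g`_i = 0.
  by move=> id; apply/eqP/negPn/negP => gi; apply: no; exists i.
have eg : g = lead_coef g *: 'X^d by apply: eq_lead_monomial.
(* The first iterate shows that [f] is a monomial plus a constant, the second that this constant is
   0. *)
have ef : f = lead_coef f *: 'X^d.
  have [a [a0 [c [e [c0 E1]]]]] := S_ex (isT : (0 < 1)%N).
  have [a2 [a20 [c2 [e2 [c20 E2]]]]] := S_ex (isT : (0 < 2)%N).
  move: E1 => /=; rewrite !comp_polyXr => E1.
  have f0 i : (0 < i < d)%N -> f`_i = 0.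
    case: i => // i id; rewrite E1 coefD coefZ coef_comp_scale g0 // coefC /= !mulr0 addr0 //.
  have eqf : f = lead_coef f *: 'X^d + (f`_0)%:P.
    rewrite -[LHS](subrK (f`_0)%:P); congr (_ + _).
    rewrite -[in RHS](lead_coef_subC f`_0); last by rewrite sf ltnS ltnW.
    apply: eq_lead_monomial => [|i id].
      by rewrite size_subC ?sf // ltnS ltnW.
    by rewrite coefB coefC; case: i id => [|i] id; rewrite ?subrr //= subr0 f0.
  have := congr1 (fun p : {poly C} => p`_(d * d.-1)) E2.
  rewrite {1}eqf coef_iter2_monomial // coefD coefZ coef_comp_scale.
  have -> : (it g 2)`_(d * d.-1) = 0.
    by have := coef_iter2_monomial (lead_coef g) 0 d_gt1; rewrite addr0 -eg mulr0 mul0rn.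
  have dd : (0 < d * d.-1)%N by rewrite muln_gt0 d_gt0 pd_gt0.
  rewrite coefC gtn_eqF // !mulr0 addr0 => /eqP.
  rewrite mulrn_eq0 mulf_eq0 expf_eq0 lead_coef_eq0 -size_poly_eq0 sf andbF /=.
  by rewrite eqn0Ngt ltnW //= => /eqP f00; rewrite {1}eqf f00 polyC0 addr0.
have lf : lead_coef f != 0 by rewrite lead_coef_eq0 -size_poly_eq0 sf.
have lg : lead_coef g != 0 by rewrite lead_coef_eq0 -size_poly_eq0 sg.
(* Conjugation by this homothety divides the leading coefficient of [f] by [a ^+ d.-1], which turns
   it into that of [g]. *)
pose a := d.-1.-root (lead_coef f / lead_coef g).
have d1 : (0 < d.-1)%N by rewrite -ltnS prednK // ltnW.
have ad : a ^+ d.-1 = lead_coef f / lead_coef g by apply: rootCK.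
have a0 : a != 0.
  have : a ^+ d.-1 != 0 by rewrite ad mulf_neq0 ?invr_eq0.
  by rewrite expf_eq0 d1.
exists a, 1, 1%N; rewrite !expr1n !scale1r comp_polyXr; split => //.
rewrite {1}ef eg comp_polyZ comp_Xn_poly exprZn !scalerA; congr (_ *: _).
have -> : a^-1 ^+ d = a^-1 * (lead_coef g / lead_coef f).
  by rewrite -[in LHS](prednK d_gt0) exprS (exprVn a d.-1) ad invf_div.
by field; rewrite a0 lf.
Qed.

End CentredIterates.
End Poly.

(** * The complex plane *)

Section ComplexPlane.
Variable R : realType.
Local Notation C := (CC R).
Implicit Types (z w c : C) (J K U : set C).

(** The norm of [CC R] is [CC R]-valued; extreme values and half-lines are available for its real
    part. *)
Definition rnorm (z : C) : R := complex.Re `|z|.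

Lemma rnormE z : `|z| = ((rnorm z)%:C%C : C).
Proof. by rewrite /rnorm RRe_real // normr_real. Qed.

Lemma real_leE (x y : R) : ((x%:C%C : C) <= y%:C%C) = (x <= y).
Proof. exact: lecR. Qed.

Lemma real_ltE (x y : R) : ((x%:C%C : C) < y%:C%C) = (x < y).
Proof. exact: ltcR. Qed.

Lemma rnorm_ge0 z : 0 <= rnorm z.
Proof. by rewrite -real_leE -rnormE normr_ge0. Qed.

Lemma ler_rnormD z w : rnorm (z + w) <= rnorm z + rnorm w.
Proof. by rewrite -real_leE rmorphD /= -!rnormE ler_normD. Qed.

Lemma rnormM z w : rnorm (z * w) = rnorm z * rnorm w.
Proof. by apply: complexI; rewrite rmorphM /= -!rnormE normrM. Qed.

Lemma norm_realC (x : R) : `|x%:C%C : C| = (`|x|%:C%C : C).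
Proof. by rewrite normc_def /= expr0n addr0 sqrtr_sqr. Qed.

Lemma realP (r : C) : r \is Num.real -> r = ((complex.Re r)%:C%C : C).
Proof. by move=> /RRe_real. Qed.

Lemma rnorm_dist_continuous c : continuous (fun z => rnorm (z - c)).
Proof.
move=> z; apply/(@cvgrPdist_lt _ _ _ _ (nbhs_filter z)) => e e0.
have e0' : 0 < (e%:C%C : C) by rewrite real_ltE.
apply: filterS (nbhsx_ballx z _ e0') => w; rewrite /ball /= => lt.
rewrite -real_ltE -norm_realC rmorphB /= -!rnormE.
by apply: le_lt_trans (ler_dist_dist _ _) _; rewrite opprB addrA subrK.
Qed.

Lemma realC_continuous : continuous (fun x : R => x%:C%C : C).
Proof.
move=> x; apply/cvgrPdist_lt => /= e e0.
have er := realP (gtr0_real e0); rewrite er in e0 *; move: e0; rewrite real_ltE => e0.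
apply: filterS (nbhsx_ballx x _ e0) => y; rewrite /ball /= => lt.
by rewrite -rmorphB norm_realC real_ltE.
Qed.

Lemma closed_disc c (r : C) : closed [set z : C | `|z - c| <= r].
Proof.
(* The order of [CC R] compares only numbers with real difference, so a non-real [r] bounds no
   norm. *)
have [rr|nr] := boolP (r \is Num.real); last first.
  rewrite (_ : mkset _ = set0); first exact: closed0.
  apply/seteqP; split => z //= le; case/negP: nr.
  by rewrite realE (le_trans (normr_ge0 _) le).
rewrite (realP rr); move: (complex.Re r) => s.
rewrite (_ : mkset _ = (fun z => rnorm (z - c)) @^-1` [set x | x <= s]); last first.
  by apply/seteqP; split => z /=; rewrite rnormE real_leE.
apply: closed_comp; last exact: closed_le.
move=> z _; exact: rnorm_dist_continuous.
Qed.

(** The disc is a closed subset of the continuous image of a square in R^2. *)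
Lemma compact_disc c (r : C) : compact [set z : C | `|z - c| <= r].
Proof.
pose f (x : R * R) : C := c + (x.1%:C%C + 'i * x.2%:C%C).
pose s := complex.Re r.
have fc : continuous f.
  move=> x; apply: cvgD; first exact: cvg_cst.
  apply: cvgD.
    apply: (@continuous_comp _ _ _ fst (fun x : R => x%:C%C : C));
      [exact: cvg_fst|exact: realC_continuous].
  apply: cvgM; first exact: cvg_cst.
  apply: (@continuous_comp _ _ _ snd (fun x : R => x%:C%C : C));
    [exact: cvg_snd|exact: realC_continuous].
have cK : compact (f @` (`[- s, s]%classic `*` `[- s, s]%classic)).
  apply: continuous_compact; first exact: continuous_subspaceT.
  by apply: compact_setX; exact: segment_compact.
refine (subclosed_compact (@closed_disc c r) cK _) => z /= le.
have rr : r \is Num.real by rewrite realE (le_trans (normr_ge0 _) le).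
have nz : rnorm (z - c) <= s by rewrite -real_leE -rnormE -(realP rr).
exists (complex.Re (z - c), complex.Im (z - c)).
  have h x : `|x| <= rnorm (z - c) -> x \in `[- s, s].
    by move=> h; rewrite in_itv /= -ler_norml (le_trans h).
  split; apply: h.
    by rewrite -real_leE -rnormE normc_ge_Re.
  rewrite -real_leE -rnormE normc_def real_leE /= -sqrtr_sqr ler_sqrt ?lerDr ?addr_ge0 ?sqr_ge0 //.
rewrite /f /= -[RHS](subrK c) addrC; congr (_ + _).
by rewrite [RHS]complexE mulrC.
Qed.

Lemma horner_continuous (p : {poly C}) : continuous (horner p).
Proof.
elim/poly_ind: p => [|p a IH] z.
  rewrite (_ : horner 0 = fun=> 0); last by apply/funext => x; rewrite horner0.
  exact: cst_continuous.
rewrite (_ : horner (p * 'X + a%:P) = fun x => p.[x] * x + a); last first.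
  by apply/funext => x; rewrite hornerMXaddC.
apply: (@continuousD _ _ _ (fun x => p.[x] * x) (fun=> a)); last exact: cst_continuous.
apply: (@continuousM _ _ (horner p) id); [exact: IH|exact: cvg_id].
Qed.

End ComplexPlane.

(** * Existence of the smallest disc and of two contact points *)

Section SmallestDiscExists.
Variable R : realType.
Local Notation C := (CC R).
Implicit Types (z w c : C) (J K U : set C).

Lemma rnorm_distC z w : rnorm (z - w) = rnorm (w - z).
Proof. by rewrite /rnorm distrC. Qed.

Lemma rnorm0P z w : (rnorm (z - w) <= 0) = (z == w).
Proof. by rewrite -real_leE -rnormE normr_le0 subr_eq0. Qed.

Lemma farthest_point J c : J !=set0 -> compact J ->
  exists2 w, J w & forall v, J v -> rnorm (v - c) <= rnorm (w - c).
Proof.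
move=> J0 cJ.
have [w /set_mem Jw h] := @compact_EVT_max _ R (fun z => rnorm (z - c)) J J0 cJ
  (continuous_subspaceT (@rnorm_dist_continuous R c)).
by exists w => // v Jv; apply/h/mem_set.
Qed.

Lemma smallest_disc J w0 w1 : compact J -> J w0 -> J w1 -> w0 != w1 ->
  exists (c r v0 v1 : C), [/\ 0 < r, forall w, J w -> `|w - c| <= r,
    forall c' r' : C, (forall w, J w -> `|w - c'| <= r') -> r <= r' &
    [/\ J v0, J v1, v0 != v1, `|v0 - c| = r & `|v1 - c| = r]].
Proof.
move=> cJ J0 J1 w01; have Jn : J !=set0 by exists w0.
have /boolp.choice[m mP] : forall c, exists w,
    J w /\ forall v, J v -> rnorm (v - c) <= rnorm (w - c).
  by move=> c; have [w Jw h] := farthest_point c Jn cJ; exists w.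
pose rho c := rnorm (m c - c).
have rhoP c w : J w -> rnorm (w - c) <= rho c by move=> Jw; apply: (mP c).2.
have lip c c' : rho c <= rho c' + rnorm (c' - c).
  have -> : rho c = rnorm ((m c - c') + (c' - c)) by rewrite addrA subrK.
  by apply: le_trans (ler_rnormD _ _) _; rewrite lerD2r rhoP //; case: (mP c).
have crho : continuous rho.
  move=> z; apply/(@cvgrPdist_lt _ _ _ _ (nbhs_filter z)) => e e0.
  have e0' : 0 < (e%:C%C : C) by rewrite real_ltE.
  apply: filterS (nbhsx_ballx z _ e0') => w; rewrite /ball /= rnormE real_ltE => lt.
  have := lip w z; have := lip z w; rewrite [rnorm (w - z)]rnorm_distC => h1 h2.
  by rewrite ltr_norml; apply/andP; split; lra.
(* A centre outside [D] is farther from [w0] than [rho w0], so a minimum of [rho] over the compact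
   [D] is global. *)
pose D := [set z : C | `|z - w0| <= ((rho w0)%:C%C : C)].
have D0 : D w0 by rewrite /D /= subrr normr0 real_leE rnorm_ge0.
have Dn : D !=set0 by exists w0.
have [c _ cmin] := @compact_EVT_min _ R rho D Dn (@compact_disc R w0 _) (continuous_subspaceT crho).
have {}cmin t : rho c <= rho t.
  have [Dt|nDt] := pselect (D t); first by apply/cmin/mem_set.
  apply: le_trans (cmin _ (mem_set D0)) _; apply: le_trans _ (rhoP t w0 J0).
  by rewrite rnorm_distC leNgt -real_ltE -rnormE; apply/negP => lt; apply: nDt; exact: ltW.
have r0 : 0 < rho c.
  rewrite ltNge; apply/negP => le0; case/negP: w01.
  have h w : J w -> w = c by move=> /(rhoP c) h; apply/eqP; rewrite -rnorm0P (le_trans h).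
  by rewrite (h _ J0) (h _ J1).
have [Jv mc] := mP c; set v0 := m c in Jv.
suff [v1 [Jv1 v01 nv1]] : exists v1, [/\ J v1, v0 != v1 & rnorm (v1 - c) = rho c].
  exists c, ((rho c)%:C%C : C), v0, v1; split.
  - by rewrite real_ltE.
  - by move=> w Jw; rewrite rnormE real_leE rhoP.
  - move=> c' r' h; have [Jm _] := mP c'.
    by apply: le_trans _ (h _ Jm); rewrite rnormE real_leE cmin.
  - by split; rewrite // rnormE // nv1.
(* If [v0] were the only contact point, moving the centre towards it would
   give a smaller disc. *)
apply: contrapT => no.
(* Points of J closer to [v0] than [rho c] end strictly inside by convexity. The others form the
   compact [J'], which has no contact point and so stays at distance at most some [s < rho c] from
   [c]. *)
pose J' := J `&` [set w | rho c <= rnorm (w - v0)].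
have [s /andP[s0 sr] sP] : exists2 s, 0 <= s < rho c & forall w, J' w -> rnorm (w - c) <= s.
  have [J'0|nJ'] := pselect (J' !=set0); last first.
    by exists 0 => [|w J'w]; [rewrite lexx r0|case: nJ'; exists w].
  have cJ' : compact J'.
    refine (subclosed_compact _ cJ _); last by move=> w [].
    apply: closedI; first exact: compact_closed (@norm_hausdorff _ _) cJ.
    apply: (closed_comp (f := fun w => rnorm (w - v0)) (D := [set x | rho c <= x])).
      by move=> w _; exact: rnorm_dist_continuous.
    exact: closed_ge.
  have [w [Jw fw] h] := farthest_point c J'0 cJ'.
  exists (rnorm (w - c)) => //; rewrite rnorm_ge0 lt_neqAle rhoP // andbT; apply/eqP => e.
  apply: no; exists w; split=> //; apply/eqP => e'.
  by move: fw => /=; rewrite -e' subrr /rnorm normr0 /= leNgt r0.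
(* The centre then moves by [(rho c - s) / 2], half of the slack that the points of [J'] have. *)
pose e := (rho c - s) / (2%:R * rho c).
have e0 : 0 < e by rewrite divr_gt0 ?subr_gt0 // mulr_gt0.
have e1 : e <= 1 by rewrite /e ler_pdivrMr ?mulr_gt0 // mul1r; lra.
pose c' := c + e%:C%C * (v0 - c).
have [Jw _] := mP c'; have := cmin c'; rewrite /rho -/(rho c); set w := m c' in Jw *.
rewrite leNgt => /negP; apply.
have [near|far] := ltP (rnorm (w - v0)) (rho c).
  have -> : w - c' = (1 - e)%:C%C * (w - c) + e%:C%C * (w - v0).
    by rewrite /c' rmorphB /= rmorph1; ring.
  have re x : 0 <= x -> rnorm (x%:C%C : C) = x.
    by move=> x0; rewrite /rnorm norm_realC ger0_norm.
  apply: le_lt_trans (ler_rnormD _ _) _; rewrite !rnormM !re ?subr_ge0 ?(ltW e0) ?(ltW e1) //.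
  have -> : rho c = (1 - e) * rho c + e * rho c by ring.
  by rewrite ler_ltD ?ler_wpM2l ?subr_ge0 ?(ltW e1) ?rhoP // ltr_pM2l.
have -> : w - c' = (w - c) + (- e%:C%C) * (v0 - c) by rewrite /c'; ring.
apply: le_lt_trans (ler_rnormD _ _) _.
rewrite rnormM {2}/rnorm normrN norm_realC ger0_norm ?(ltW e0) //=.
rewrite -/(rho c); have := sP w (conj Jw far); rewrite /e => h.
apply: le_lt_trans (lerD h (lexx _)) _.
have -> : (rho c - s) / (2 * rho c) * rho c = (rho c - s) / 2.
  by field; rewrite gt_eqF.
lra.
Qed.

Lemma invariant_centre J w0 w1 : compact J -> J w0 -> J w1 -> w0 != w1 ->
  exists c, forall p q : {poly C}, (1 < size p)%N -> size q = size p ->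
    (forall z, J p.[z] <-> J z) -> (forall z, J q.[z] <-> J z) ->
    exists2 u, `|u| = 1 & q - c%:P = u *: (p - c%:P).
Proof.
move=> cJ J0 J1 w01.
have [c [r [v0 [v1 [r0 inr rmin [Jv0 Jv1 v01 e0 e1]]]]]] := smallest_disc cJ J0 J1 w01.
exists c => p q sp sq Jp Jq.
exact: (same_invariant_set inr rmin r0 sp sq Jp Jq Jv0 Jv1 v01 e0 e1).
Qed.
End SmallestDiscExists.

(** * Normality and Julia sets *)

Section Normality.
Variable R : realType.
Local Notation C := (CC R).
Implicit Types (z w c : C) (J K U : set C) (G F : nat -> C -> C) (f g : {poly C}).

(** The two alternatives of [normal_on], with uniform convergence in epsilon form. *)
Definition spherical_cvg U G : Prop :=
  (exists l : C -> C, forall K, compact K -> K `<=` U -> forall e : C, 0 < e ->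
     \forall k \near \oo, forall z, K z -> `|l z - G k z| < e) \/
  (forall K, compact K -> K `<=` U -> forall M : R,
     \forall k \near \oo, forall z, K z -> (M%:C%C : C) < `|G k z|).

Lemma uniform_cvgP K G (l : C -> C) : {uniform K, G @ \oo --> l} <->
  forall e : C, 0 < e -> \forall k \near \oo, forall z, K z -> `|l z - G k z| < e.
Proof.
split=> [h e e0|h].
  apply: (h [set g | forall z, K z -> `|l z - g z| < e]); apply/uniform_nbhs.
  exists [set xy : C * C | ball xy.1 e xy.2]; split; last by move=> g.
  by rewrite -entourage_from_ballE; exists e.
move=> P /uniform_nbhs [E []]; rewrite -entourage_from_ballE => -[e /= e0 eE] EP.
have [N _ hN] := h e e0; exists N => // n /hN Gn; apply: EP => z Kz; apply: eE.
exact: Gn.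
Qed.

Lemma normal_onP U F : normal_on U F <-> forall u : nat -> nat, exists phi : nat -> nat,
  {homo phi : m n / (m < n)%N >-> (m < n)%N} /\ spherical_cvg U (fun k => F (u (phi k))).
Proof.
have eqv G (l : C -> C) : {family [set K | compact K /\ K `<=` U], G @ \oo --> l} <->
   forall K, compact K -> K `<=` U -> forall e : C, 0 < e ->
     \forall k \near \oo, forall z, K z -> `|l z - G k z| < e.
  split=> [/fam_cvgP h K cK KU|h]; first by apply/uniform_cvgP/h.
  by apply/fam_cvgP => K [cK KU]; apply/uniform_cvgP/h.
split=> h u; have [phi [inc [[l hl]|hl]]] := h u; exists phi; split => //; try by right.
  by left; exists l; apply/eqv.
by left; exists l; apply/eqv.
Qed.

Lemma subsequence_of_often (P : nat -> nat -> Prop) :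
  (forall k N, exists2 n, (N <= n)%N & P k n) ->
  exists phi : nat -> nat, {homo phi : m n / (m < n)%N >-> (m < n)%N} /\ forall k, P k (phi k).
Proof.
move=> h; have /boolp.choice[s sP] : forall kN : nat * nat, exists n, (kN.2 <= n)%N /\ P kN.1 n.
  by move=> [k N]; have [n Nn Pn] := h k N; exists n.
pose phi := fix phi k := if k is k'.+1 then s (k, (phi k').+1) else s (0, 0)%N.
exists phi; split; last by case=> [|k]; [have [] := sP (0, 0)%N|have [] := sP (k.+1, (phi k).+1)].
by apply: homo_ltn ltn_trans _ => i; have [] := sP (i.+1, (phi i).+1).
Qed.

(** [normal_on] quantifies over all sequences of indices, bounded ones included. A sequence that
    takes no value infinitely often tends to infinity; otherwise a constant subsequence exists,
    along which convergence is trivial. *)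
Lemma subsequence_dichotomy (u : nat -> nat) : exists phi : nat -> nat,
  {homo phi : m n / (m < n)%N >-> (m < n)%N} /\
  ((exists m, forall k, u (phi k) = m) \/ forall k, (k <= u (phi k))%N).
Proof.
have [[m hm]|no] := pselect (exists m, forall N, exists2 n, (N <= n)%N & u n = m).
  have [|phi [inc e]] := @subsequence_of_often (fun _ n => u n = m); first by [].
  by exists phi; split => //; left; exists m.
have fin M : exists N, forall n, (N <= n)%N -> (M <= u n)%N.
  elim: M => [|M [N hN]]; first by exists 0%N.
  have [N' hN'] : exists N', forall n, (N' <= n)%N -> u n <> M.
    apply: contrapT => /forallNP h; apply: no; exists M => N'; apply: contrapT => h'.
    by apply: (h N') => n Nn e; apply: h'; exists n.
  exists (maxn N N') => n; rewrite geq_max => /andP[/hN le /hN' ne].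
  by rewrite ltn_neqAle le andbT eq_sym; apply/eqP.
have [|phi [inc e]] := @subsequence_of_often (fun k n => (k <= u n)%N).
  move=> k N; have [N' hN'] := fin k; exists (maxn N N'); rewrite ?leq_maxl // hN' //.
  exact: leq_maxr.
by exists phi; split => //; right.
Qed.

Lemma spherical_cvg_cst U (g : C -> C) : spherical_cvg U (fun=> g).
Proof.
by left; exists g => K _ _ e e0; exists 0%N => // n _ z _; rewrite subrr normr0.
Qed.

Lemma normal_onI U F : (forall u : nat -> nat, (forall k, (k <= u k)%N) ->
    exists phi : nat -> nat, {homo phi : m n / (m < n)%N >-> (m < n)%N} /\
      spherical_cvg U (fun k => F (u (phi k)))) ->
  normal_on U F.
Proof.
move=> h; apply/normal_onP => u; have [phi [inc [[m e]|e]]] := subsequence_dichotomy u.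
  exists phi; split => //; rewrite (_ : (fun k => _) = fun=> F m); first exact: spherical_cvg_cst.
  by apply/funext => k; rewrite e.
have [psi [inc' c]] := h _ e; exists (phi \o psi); split => // m n mn.
by apply/inc/inc'.
Qed.

Lemma iterpS f n : iterp f n.+1 = f \Po iterp f n.
Proof. by []. Qed.

Lemma horner_iterp f n z : (iterp f n).[z] = iter n (horner f) z.
Proof. exact: horner_iter_comp. Qed.

Lemma horner_iterpSr f n z : (iterp f n.+1).[z] = (iterp f n).[f.[z]].
Proof. by rewrite !horner_iterp iterSr. Qed.

Lemma fatou_open f : open (Defs.fatou f).
Proof.
rewrite openE => z [U [oU Uz] nU].
by apply: filterS (open_nbhs_nbhs (conj oU Uz)) => w Uw; exists U.
Qed.

Lemma julia_closed f : closed (julia f).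
Proof. by apply: open_closedC; exact: fatou_open. Qed.

Lemma escape_radius f : (2 < size f)%N ->
  exists2 r : C, 1 <= r & forall z, r <= `|z| -> 2%:R * `|z| <= `|f.[z]|.
Proof.
move=> sz; pose m := (size f).-2; have sf : size f = m.+2 by rewrite /m; case: (size f) sz => [|[]].
have m0 : (0 < m)%N by rewrite sf in sz.
pose A := `|lead_coef f|; pose M := \sum_(i < m.+1) `|f`_i|.
have A0 : 0 < A by rewrite normr_gt0 lead_coef_eq0 -size_poly_eq0 sf.
have M0 : 0 <= M by apply: sumr_ge0.
(* Beyond this radius [x >= 1] and [A * x - M >= 2], so the value has norm at least [2 * x ^+ m],
   with [m >= 1]. *)
exists (1 + (M + 2%:R) / A); first by rewrite lerDl divr_ge0 ?addr_ge0 ?(ltW A0).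
move=> z rz; set x := `|z| in rz *.
have x1 : 1 <= x by apply: le_trans rz; rewrite lerDl divr_ge0 ?addr_ge0 ?(ltW A0).
have x0 : 0 <= x by apply: le_trans x1.
have xA : 2%:R <= A * x - M.
  have : M + 2%:R <= A * x.
    rewrite mulrC -ler_pdivrMr //; apply: le_trans rz; by rewrite lerDr.
  by rewrite lerBrDl.
have -> : f.[z] = lead_coef f * z ^+ m.+1 + \sum_(i < m.+1) f`_i * z ^+ i.
  by rewrite horner_coef sf big_ord_recr /= addrC lead_coefE sf.
have lowb : `|\sum_(i < m.+1) f`_i * z ^+ i| <= M * x ^+ m.
  apply: le_trans (ler_norm_sum _ _ _) _; rewrite /M mulr_suml; apply: ler_sum => i _.
  by rewrite normrM normrX ler_wpM2l // ler_weXn2l // -ltnS.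
apply: le_trans (lerB_normD _ _).
apply: le_trans (lerB (lexx _) lowb); rewrite normrM normrX -/A -/x exprS.
have -> : A * (x * x ^+ m) - M * x ^+ m = (A * x - M) * x ^+ m by ring.
by apply: ler_pM => //; rewrite -{1}[x]expr1 ler_weXn2l.
Qed.
End Normality.

(** * Invariance, compactness and size of the Julia set *)

Section JuliaSet.
Variable R : realType.
Local Notation C := (CC R).
Implicit Types (a b z w c v : C) (J K U : set C) (G F : nat -> C -> C) (f g : {poly C}).

Lemma spherical_cvg_ext U G G' : (forall k z, U z -> G k z = G' k z) ->
  spherical_cvg U G -> spherical_cvg U G'.
Proof.
move=> e [[l hl]|h]; [left; exists l|right] => K cK KU.
  move=> eps eps0; have [N _ hN] := hl K cK KU _ eps0.
  by exists N => // n Nn z Kz; rewrite -e ?hN //; apply: KU.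
move=> M; have [N _ hN] := h K cK KU M.
by exists N => // n Nn z Kz; rewrite -e ?hN //; apply: KU.
Qed.

Lemma spherical_cvg_comp U (p : {poly C}) G : spherical_cvg U G ->
  spherical_cvg (horner p @^-1` U) (fun k z => G k p.[z]).
Proof.
have img K : compact K -> K `<=` horner p @^-1` U ->
    compact (horner p @` K) /\ horner p @` K `<=` U.
  move=> cK KU; split; last by move=> _ [z Kz <-]; apply: KU.
  by apply: continuous_compact => //; apply/continuous_subspaceT/horner_continuous.
move=> [[l hl]|h]; [left; exists (fun z => l p.[z])|right] => K cK /(img _ cK)[cK' KU'].
  move=> e e0; have [N _ hN] := hl _ cK' KU' e e0.
  by exists N => // n Nn z Kz; apply: hN => //; exists z.
move=> M; have [N _ hN] := h _ cK' KU' M.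
by exists N => // n Nn z Kz; apply: hN => //; exists z.
Qed.

Lemma preimage_open (p : {poly C}) U : open U -> open (horner p @^-1` U).
Proof. by move=> oU; apply: open_comp => // z _; exact: horner_continuous. Qed.

Lemma fatou_preimage f z : Defs.fatou f f.[z] -> Defs.fatou f z.
Proof.
move=> [U [oU Uz] nU]; exists (horner f @^-1` U); first by split; [exact: preimage_open|].
apply: normal_onI => u ku; have /normal_onP h := nU.
(* The shift makes [u k.+1] positive, so that its predecessor is not truncated. *)
have [psi [inc c]] := h (fun k => (u k.+1).-1).
exists (fun k => (psi k).+1); split; first by move=> m n mn; rewrite ltnS inc.
apply: spherical_cvg_ext (spherical_cvg_comp f c) => k w _.
by rewrite -horner_iterpSr prednK // (leq_trans _ (ku _)).
Qed.

(** If all roots of [f - w] were at distance at least [r] from [z], the factorization of [f - w] at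
    [z] would bound the distance from [w] to the value at [z] below by [|lead_coef f|] times [r] to
    the degree. This bound is the chosen [e]. *)
Lemma polynomial_open_mapping f z (r : C) : (1 < size f)%N -> 0 < r ->
  exists2 e : C, 0 < e & forall w, `|f.[z] - w| < e -> exists2 v, `|v - z| <= r & f.[v] = w.
Proof.
move=> sf r0; have lf : lead_coef f != 0 by rewrite lead_coef_eq0 -size_poly_gt0 ltnW.
exists (`|lead_coef f| * r ^+ (size f).-1); first by rewrite mulr_gt0 ?normr_gt0 ?exprn_gt0.
move=> w lt; have [s [ss es]] := fibreP w sf; have hs := fibre_eq es.
apply: contrapT => no.
have far v : v \in s -> r <= `|z - v|.
  move=> vs; apply: contrapT => /negP nle; apply: no; exists v; last exact: hs.
  by rewrite distrC; move: nle; rewrite -real_ltNge ?normr_real ?gtr0_real // => /ltW.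
have : `|lead_coef f| * r ^+ (size f).-1 <= `|f.[z] - w|.
  have -> : f.[z] - w = (f - w%:P).[z] by rewrite hornerD hornerN hornerC.
  rewrite es hornerZ normrM ler_wpM2l // -ss.
  elim: (s) far => [|v t IH] far; first by rewrite big_nil hornerC normr1.
  rewrite big_cons hornerM hornerXsubC normrM exprS ler_pM ?exprn_ge0 ?(ltW r0) //.
    by rewrite far ?mem_head.
  by apply: IH => x xt; rewrite far // in_cons xt orbT.
by move/(lt_le_trans lt); rewrite ltxx.
Qed.

Lemma fatou_image f z : (1 < size f)%N -> Defs.fatou f z -> Defs.fatou f f.[z].
Proof.
move=> sf [U [oU Uz] /normal_onP nU].
have /nbhs_ballP[r /= r0 rU] : nbhs z U by apply: open_nbhs_nbhs.
pose V := [set v : C | `|v - z| <= r / 2%:R].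
have VU : V `<=` U.
  move=> v /= Vv; apply: rU; rewrite /ball /= distrC (le_lt_trans Vv) //.
  by rewrite ltr_pdivrMr ?ltr0n // ltr_pMr // ltr1n.
have r20 : 0 < r / 2%:R by rewrite divr_gt0 ?ltr0n.
have [e e0 he] := polynomial_open_mapping z sf r20.
exists (ball f.[z] e); first by split; [exact: ball_open|exact: ballxx].
(* The section [s] need not be continuous: convergence is uniform on the whole compact [V], which
   contains all the values of [s] that occur. *)
have /boolp.choice[s sP] : forall w, exists v, ball f.[z] e w -> V v /\ f.[v] = w.
  move=> w; have [Bw|nB] := pselect (ball f.[z] e w); last by exists 0.
  by have [v Vv fv] := he w Bw; exists v.
have cV : compact V by exact: compact_disc.
apply/normal_onP => u; have [psi [inc c]] := nU (fun k => (u k).+1).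
exists psi; split => //; move: c => [[l hl]|h]; [left; exists (l \o s)|right] => K cK KB.
  move=> d d0; have [N _ hN] := hl V cV VU d d0; exists N => // n Nn w Kw.
  by have [Vs fs] := sP w (KB _ Kw); rewrite -[X in (iterp _ _).[X]]fs -horner_iterpSr; exact: hN.
move=> M; have [N _ hN] := h V cV VU M; exists N => // n Nn w Kw.
by have [Vs fs] := sP w (KB _ Kw); rewrite -[X in (iterp _ _).[X]]fs -horner_iterpSr; exact: hN.
Qed.

Lemma julia_invariant f z : (1 < size f)%N -> julia f f.[z] <-> julia f z.
Proof.
by move=> sf; split; apply: contra_not; [exact: fatou_image|exact: fatou_preimage].
Qed.

Lemma julia_iterp_invariant f n z : (1 < size f)%N -> julia f (iterp f n).[z] <-> julia f z.
Proof.
move=> sf; elim: n => [|n IH]; first by rewrite hornerX.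
by rewrite iterpS horner_comp; split => [/julia_invariant-/(_ sf)/IH|/IH h] //; apply/julia_invariant.
Qed.

Lemma escape_growth f (r : C) : 1 <= r -> (forall z, r <= `|z| -> 2%:R * `|z| <= `|f.[z]|) ->
  forall n z, r <= `|z| -> 2%:R ^+ n * `|z| <= `|(iterp f n).[z]|.
Proof.
move=> r1 hr; elim=> [|n IH] z rz; first by rewrite hornerX mul1r.
have r0 : 0 <= r by apply: le_trans r1.
rewrite iterpS horner_comp; apply: le_trans (hr _ _).
  by rewrite exprS -mulrA ler_wpM2l // IH.
apply: le_trans (IH z rz); apply: le_trans rz _.
by rewrite ler_peMl // exprn_ege1 // ler1n.
Qed.

Lemma escape_unbounded f (r : C) : 1 <= r -> (forall z, r <= `|z| -> 2%:R * `|z| <= `|f.[z]|) ->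
  forall (M : R), exists N, forall n z, (N <= n)%N ->
    r <= `|z| -> (M%:C%C : C) < `|(iterp f n).[z]|.
Proof.
move=> r1 hr M; exists (Num.bound `|M|) => n z Nn rz.
apply: lt_le_trans (escape_growth r1 hr n rz).
have z1 : 1 <= `|z| by apply: le_trans rz.
apply: (@lt_le_trans _ _ (n%:R)).
  rewrite -[n%:R](rmorph_nat (real_complex R)) real_ltE.
  apply: le_lt_trans (ler_norm M) _; apply: lt_le_trans (archi_boundP (normr_ge0 M)) _.
  by rewrite ler_nat.
apply: le_trans (ler_peMr _ z1); last by rewrite exprn_ge0.
by rewrite -natrX ler_nat ltnW // ltn_expl.
Qed.

Lemma julia_bounded f : (2 < size f)%N -> exists r : C, forall z, julia f z -> `|z - 0| <= r.
Proof.
move=> sf; have [r r1 hr] := escape_radius sf; exists r => z Jz; rewrite subr0.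
have r0 : r \is Num.real by rewrite realE (le_trans _ r1).
rewrite real_leNgt ?normr_real //; apply/negP => rz; apply: Jz.
have sub : ~` [set w : C | `|w - 0| <= r] `<=` [set w | r <= `|w|].
  by move=> w /= /negP; rewrite subr0 -real_ltNge ?normr_real // => /ltW.
exists (~` [set w : C | `|w - 0| <= r]).
  split; first by apply: closed_openC; exact: closed_disc.
  by apply/negP; rewrite subr0 -real_ltNge ?normr_real.
apply: normal_onI => u ku; exists id; split => //; right => K cK KU M.
have [N hN] := escape_unbounded r1 hr M; exists N => // n Nn w Kw.
by apply: hN; [exact: leq_trans Nn (ku n)|exact/sub/KU].
Qed.

Lemma julia_compact f : (2 < size f)%N -> compact (julia f).
Proof.
move=> sf; have [r hr] := julia_bounded sf.
exact: (subclosed_compact (@julia_closed R f) (@compact_disc R 0 r) hr).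
Qed.

(* In the Fatou set escaping is locally constant, so an empty Julia set would
   make the filled Julia set clopen. *)
Lemma julia_nonempty f : (2 < size f)%N -> julia f !=set0.
Proof.
move=> sf; have [r r1 hr] := escape_radius sf; apply: contrapT => /forallNP J0.
have rr : r \is Num.real by rewrite realE (le_trans _ r1).
pose E := [set z : C | exists n, r < `|(iterp f n).[z]|].
have oE : open E.
  rewrite (_ : E = \bigcup_n (horner (iterp f n) @^-1` (~` [set w : C | `|w - 0| <= r]))).
    apply: bigcup_open => n _; apply: preimage_open; apply: closed_openC; exact: closed_disc.
  apply/seteqP; split => z [n].
    by move=> h; exists n => //=; apply/negP; rewrite subr0 -real_ltNge ?normr_real.
  by move=> _ /= /negP; rewrite subr0 -real_ltNge ?normr_real // => h; exists n.
have escE z M : E z -> exists N, forall n, (N <= n)%N -> (M%:C%C : C) < `|(iterp f n).[z]|.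
  move=> [m hm]; have [N hN] := escape_unbounded r1 hr M; exists (N + m)%N => n Nn.
  have -> : (iterp f n).[z] = (iterp f (n - m)).[(iterp f m).[z]].
    by rewrite !horner_iterp -iterD subnK // (leq_trans _ Nn) ?leq_addl.
  by apply: hN; [rewrite -(leq_add2r m) subnK // (leq_trans _ Nn) ?leq_addl|exact: ltW].
have bndE z : ~ E z -> forall n, `|(iterp f n).[z]| <= r.
  by move=> nE n; rewrite real_leNgt ?normr_real //; apply/negP => h; apply: nE; exists n.
have oK : open (~` E).
  rewrite openE => z nEz; have /contrapT[U [oU Uz] /normal_onP nU] := J0 z.
  apply: filterS (open_nbhs_nbhs (conj oU Uz)) => w Uw Ew.
  have [phi [inc c]] := nU id.
  have phik k : (k <= phi k)%N.
    by elim: k => // k IH; apply: leq_ltn_trans IH _; apply: inc.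
  have sub x : U x -> [set x] `<=` U by move=> Ux _ ->.
  (* A finite limit contradicts the escape of [w], divergence to infinity the bounded orbit of
     [z]. *)
  case: c => [[l hl]|h].
    have [N _ hN] := hl _ (@compact_set1 _ w) (sub _ Uw) 1 ltr01.
    have [N' hN'] := escE w (rnorm (l w) + 1) Ew.
    pose n := maxn N N'; have := hN n (leq_maxl _ _) w erefl.
    have := hN' (phi n) (leq_trans (leq_maxr _ _) (phik n)).
    rewrite rmorphD /= -rnormE rmorph1 => h1 h2.
    have := ler_normD (l w) ((iterp f (phi n)).[w] - l w); rewrite addrC subrK distrC => h3.
    by have := lt_trans h1 (le_lt_trans h3 (ler_ltD (lexx _) h2)); rewrite ltxx.
  have [N _ hN] := h _ (@compact_set1 _ z) (sub _ Uz) (complex.Re r).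
  have := hN N (leqnn N) z erefl; rewrite -(realP rr) => /lt_le_trans/(_ (bndE _ nEz _)).
  by rewrite ltxx.
(* A fixed point does not escape, so the complement of [E] is nonempty. *)
have [z0 /eqP fz0] : exists x, root (f - 'X) x.
  apply/closed_rootP; rewrite size_polyDl ?size_polyN ?size_polyX //.
  by case: (size f) sf => [|[|[]]].
have nE0 : ~ E z0.
  move=> Ez0; have [N hN] := escE z0 (rnorm z0) Ez0; have := hN N (leqnn N).
  have -> : (iterp f N).[z0] = z0.
    rewrite horner_iterp; elim: N {hN} => //= n ->.
    by apply/eqP; rewrite -subr_eq0 -fz0 hornerD hornerN hornerX.
  by rewrite -rnormE ltxx.
pose z1 := r + 1.
have E1 : E z1.
  exists 0%N; rewrite hornerX ger0_norm ?ltrDl ?ltr01 //.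
  by rewrite addr_ge0 // (le_trans _ r1).
(* Along the real line through [z0] and [z1], connectedness of [R] suffices. *)
pose h (t : R) : C := z0 + t%:C%C * (z1 - z0).
have ch : continuous h.
  move=> t; apply: (@continuousD _ _ _ (fun=> z0) (fun t : R => t%:C%C * (z1 - z0))).
    exact: cst_continuous.
  apply: (@continuousM _ _ (fun t : R => t%:C%C : C) (fun=> z1 - z0)).
    exact: realC_continuous.
  exact: cst_continuous.
have cR : connected [set: R] by apply/connected_intervalP.
have oh (A : set C) : open A -> open (h @^-1` A).
  by move=> oA; apply: open_comp => // t _; exact: ch.
have KT : h @^-1` (~` E) = setT.
  apply: cR; first by exists 0; rewrite /h /= mul0r addr0.
    by exists (h @^-1` (~` E)); rewrite ?setTI //; exact: oh.
  exists (h @^-1` (~` E)); last by rewrite setTI.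
  by rewrite preimage_setC; exact: (open_closedC (oh _ oE)).
have : (h @^-1` (~` E)) 1 by rewrite KT.
by rewrite /h /= rmorph1 mul1r addrC subrK.
Qed.

Lemma superattracting_fatou (a v : C) (d : nat) : (1 < d)%N ->
  Defs.fatou (a *: ('X - v%:P) ^+ d + v%:P) v.
Proof.
move=> d1; set f := _ + _.
have fz z : `|f.[z] - v| = `|a| * `|z - v| ^+ d.
  by rewrite /f hornerD hornerZ horner_exp hornerXsubC hornerC addrK normrM normrX.
(* Chosen so that [e <= 1] and [|a| * e <= 1/2]: as [d >= 2], each application at least halves the
   distance to [v]. *)
pose e : C := (2%:R * (`|a| + 1))^-1.
have e0 : 0 < e by rewrite invr_gt0 mulr_gt0 ?ltr_wpDl.
have e1 : e <= 1.
  rewrite invf_le1 ?mulr_gt0 ?ltr_wpDl //.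
  by rewrite mulr_ege1 ?ler1n ?lerDr.
have ae : `|a| * e <= 2%:R^-1.
  rewrite /e invfM mulrCA -[leRHS]mulr1 ler_wpM2l ?invr_ge0 //.
  by rewrite ler_pdivrMr ?ltr_wpDl // mul1r lerDl.
have step z : `|z - v| <= e -> `|f.[z] - v| <= `|z - v| / 2%:R.
  move=> ze; rewrite fz -(prednK (ltnW d1)) exprS mulrCA ler_wpM2l //.
  apply: le_trans ae; rewrite ler_wpM2l //.
  have d2 : (0 < d.-1)%N by rewrite -ltnS prednK // ltnW.
  rewrite -(prednK d2) exprS -[leRHS]mulr1 ler_pM ?exprn_ge0 //.
  by rewrite exprn_ile1 // (le_trans ze).
have iterE n z : `|z - v| <= e -> `|(iterp f n).[z] - v| <= e / 2%:R ^+ n.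
  move=> ze; elim: n => [|n IH]; first by rewrite hornerX expr0 divr1.
  have le : e / 2%:R ^+ n <= e.
    by rewrite ler_pdivrMr ?exprn_gt0 // ler_peMr ?(ltW e0) // exprn_ege1 // ler1n.
  rewrite iterpS horner_comp (le_trans (step _ (le_trans IH le))) //.
  by rewrite exprSr invfM mulrA ler_wpM2r ?invr_ge0.
exists (ball v e); first by split; [exact: ball_open|exact: ballxx].
apply: normal_onI => u ku; exists id; split => //; left; exists (fun=> v) => K _ KB eps eps0.
have [s s0 es] : exists2 s : R, 0 < s & eps = (s%:C%C : C).
  exists (complex.Re eps); last exact: realP (gtr0_real eps0).
  by rewrite -real_ltE -(realP (gtr0_real eps0)).
exists (Num.bound s^-1) => // n /= Nn z /KB; rewrite /ball /= distrC => /ltW ze.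
rewrite distrC (le_lt_trans (iterE _ _ ze)) // (le_lt_trans (y := (2%:R ^+ u n)^-1)) //.
  by rewrite ler_pdivrMr ?exprn_gt0 // mulVf // expf_neq0.
rewrite es invf_plt ?posrE ?exprn_gt0 ?real_ltE //.
apply: (@lt_le_trans _ _ ((n%:R : R)%:C%C)).
  rewrite -fmorphV real_ltE (lt_le_trans (archi_boundP _)) ?invr_ge0 ?(ltW s0) //.
  by rewrite ler_nat.
by rewrite rmorph_nat -natrX ler_nat (leq_trans (ku n)) // ltnW // ltn_expl.
Qed.

(** If J were [{v}], complete invariance would make [v] the only preimage of [v], so [f] would be
    [a (X - v)^d + v], whose superattracting fixed point [v] lies in the Fatou set. *)
Lemma julia_two_points f : (2 < size f)%N -> exists z w, [/\ julia f z, julia f w & z != w].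
Proof.
move=> sf; have sf1 := ltnW sf; have [v Jv] := julia_nonempty sf; apply: contrapT => no.
have all_v z : julia f z -> z = v.
  by move=> Jz; apply/eqP/negPn/negP => ne; apply: no; exists z, v.
have [s [ss es]] := fibreP v sf1; have hs := fibre_eq es.
have sv : s = nseq (size s) v.
  apply/all_pred1P/allP => z zs /=; apply/eqP/all_v; apply/julia_invariant => //.
  by rewrite hs.
have ef : f = lead_coef f *: ('X - v%:P) ^+ size s + v%:P.
  apply/eqP; rewrite -subr_eq {1}es sv size_nseq; apply/eqP; congr (_ *: _).
  by rewrite big_nseq iter_mulr_1.
apply: (Jv); rewrite ef; apply: superattracting_fatou.
by rewrite ss; case: (size f) sf => [|[|[]]].
Qed.
End JuliaSet.

(** * Julia sets under conjugation and under roots of unity *)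

Section JuliaConjugation.
Variable R : realType.
Local Notation C := (CC R).
Implicit Types (a b z w c u v : C) (J K U : set C) (G F : nat -> C -> C) (f g : {poly C}).

Lemma spherical_cvg_affine U G a b : a != 0 -> spherical_cvg U G ->
  spherical_cvg U (fun k z => a * G k z + b).
Proof.
move=> a0; have na : 0 < `|a| by rewrite normr_gt0.
move=> [[l hl]|h]; [left; exists (fun z => a * l z + b)|right] => K cK KU.
  move=> e e0; have [N _ hN] := hl K cK KU (e / `|a|) (divr_gt0 e0 na).
  exists N => // n Nn z Kz; rewrite opprD addrACA subrr addr0 -mulrBr normrM.
  by rewrite mulrC -ltr_pdivlMr // hN.
move=> M; have [N _ hN] := h K cK KU ((M + rnorm b) / rnorm a).
exists N => // n Nn z Kz; have := hN n Nn z Kz; rewrite fmorph_div rmorphD /= -!rnormE.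
rewrite ltr_pdivrMr // mulrC -normrM -ltrBrDr => h1.
by apply: lt_le_trans h1 _; apply: lerB_normD.
Qed.

Lemma spherical_cvg_subseq U G (psi : nat -> nat) : {homo psi : m n / (m < n)%N >-> (m < n)%N} ->
  spherical_cvg U G -> spherical_cvg U (fun k => G (psi k)).
Proof.
move=> inc; have le k : (k <= psi k)%N.
  by elim: k => // k IH; apply: leq_ltn_trans IH _; apply: inc.
move=> [[l hl]|h]; [left; exists l|right] => K cK KU.
  move=> e e0; have [N _ hN] := hl K cK KU e e0.
  by exists N => // n Nn z Kz; apply: hN => //; exact: leq_trans Nn (le n).
move=> M; have [N _ hN] := h K cK KU M.
by exists N => // n Nn z Kz; apply: hN => //; exact: leq_trans Nn (le n).
Qed.

(** Modulo [j] the exponents take finitely many values, so the factor is constant along a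
    subsequence; the dichotomy of subsequences serves as pigeonhole principle. *)
Lemma normal_on_unity_root U F F' u (j : nat) (e : nat -> nat) : (0 < j)%N -> u ^+ j = 1 ->
  (forall n z, F' n z = u ^+ e n * F n z) -> normal_on U F -> normal_on U F'.
Proof.
move=> j0 uj eF /normal_onP nU; apply/normal_onP => v; have [phi [inc c]] := nU v.
have u0 : u != 0 by apply: contra_eq_neq uj => ->; rewrite expr0n gtn_eqF // eq_sym oner_eq0.
have [psi [inc' [[m em]|le]]] := subsequence_dichotomy (fun k => e (v (phi k)) %% j)%N; last first.
  by have := le j; rewrite leqNgt ltn_mod j0.
exists (phi \o psi); split; first by move=> x y xy; apply/inc/inc'.
have u0m : u ^+ m != 0 by rewrite expf_neq0.
apply: spherical_cvg_ext (spherical_cvg_affine 0 u0m (spherical_cvg_subseq inc' c)) => k z _ /=.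
rewrite eF addr0 -(em k) [in RHS](divn_eq (e (v (phi (psi k)))) j) exprD mulnC exprM uj.
by rewrite expr1n mul1r.
Qed.

Lemma affine_invK a b : a != 0 -> affine a b \Po affine_inv a b = 'X.
Proof.
by move=> a0; rewrite /affine affine_comp /affine_inv scalerA divff // scale1r subrK.
Qed.

Lemma affineK a b : a != 0 -> affine_inv a b \Po affine a b = 'X.
Proof.
move=> a0; rewrite /affine_inv comp_polyZ comp_polyB comp_polyX comp_polyC /affine addrK.
by rewrite scalerA mulVf // scale1r.
Qed.

Lemma horner_affine a b z : (affine a b).[z] = a * z + b.
Proof. by rewrite /affine !hornerE. Qed.

Lemma horner_affine_inv a b z : (affine_inv a b).[z] = a^-1 * (z - b).
Proof. by rewrite /affine_inv !hornerE. Qed.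

Definition conjp f a b := affine_inv a b \Po (f \Po affine a b).

Lemma iterp_conj f a b n : a != 0 -> iterp (conjp f a b) n = conjp (iterp f n) a b.
Proof.
move=> a0; elim: n => [|n IH]; first by rewrite /conjp /iterp /= comp_polyX affineK.
rewrite iterpS IH /conjp iterpS -!comp_polyA; congr (_ \Po (_ \Po _)).
by rewrite (comp_polyA (affine a b)) affine_invK // comp_polyX.
Qed.

Lemma conjpK f a b : a != 0 -> conjp (conjp f a b) a^-1 (- b / a) = f.
Proof.
move=> a0; have e1 : affine a^-1 (- b / a) = affine_inv a b.
  by rewrite /affine /affine_inv scalerBr -[_ *: b%:P]mul_polyC -polyCM mulNr polyCN [b * _]mulrC.
have e2 : affine_inv a^-1 (- b / a) = affine a b.
  rewrite /affine /affine_inv invrK scalerBr -[a *: _%:P]mul_polyC -polyCM mulrCA divff //.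
  by rewrite mulr1 polyCN opprK.
rewrite /conjp e1 e2 -!comp_polyA affine_invK // comp_polyXr comp_polyA affine_invK //.
by rewrite comp_polyX.
Qed.

Lemma fatou_conj f a b z : a != 0 -> Defs.fatou f (a * z + b) -> Defs.fatou (conjp f a b) z.
Proof.
move=> a0 [U [oU Uz] /normal_onP nU]; exists (horner (affine a b) @^-1` U).
  by split; [exact: preimage_open|rewrite /= horner_affine].
apply/normal_onP => u; have [phi [inc c]] := nU u; exists phi; split => //.
have ai0 : a^-1 != 0 by rewrite invr_eq0.
apply: spherical_cvg_ext (spherical_cvg_affine (- (a^-1 * b)) ai0
  (spherical_cvg_comp (affine a b) c)).
by move=> k w _; rewrite iterp_conj // /conjp !horner_comp horner_affine_inv mulrBr.
Qed.

Lemma julia_conj f a b z : a != 0 -> julia (conjp f a b) z <-> julia f (a * z + b).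
Proof.
move=> a0; split; apply: contra_not; first exact: fatou_conj.
rewrite -{2}(conjpK f b a0) => h; apply: fatou_conj; first by rewrite invr_eq0.
by have -> : a^-1 * (a * z + b) + - b / a = z by field.
Qed.

Lemma julia_affine_equiv_conj f a b : a != 0 -> julia_affine_equiv f (conjp f a b).
Proof.
move=> a0; exists a, b; split => //; apply/seteqP; split => z /=.
  by move=> [w /julia_conj-/(_ a0) Jw <-]; rewrite horner_affine.
move=> Jz; exists (a^-1 * (z - b)); rewrite ?horner_affine ?mulVKf ?subrK //.
by apply/julia_conj; rewrite ?mulVKf ?subrK.
Qed.

Lemma julia_affine_equiv_trans f g h : julia_affine_equiv f g -> julia_affine_equiv g h ->
  julia_affine_equiv f h.
Proof.
move=> [a [b [a0 e]]] [a' [b' [a0' e']]]; exists (a * a'), (a * b' + b); rewrite mulf_neq0 //.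
split => //; rewrite -e -e' image_comp; congr (_ @` _); apply/funext => z /=.
by rewrite !horner_affine; ring.
Qed.

Lemma julia_affine_equiv_sym f g : julia_affine_equiv f g -> julia_affine_equiv g f.
Proof.
move=> [a [b [a0 e]]]; exists a^-1, (- b / a); rewrite invr_eq0; split => //.
rewrite -e image_comp -[RHS]image_id; congr (_ @` _); apply/funext => z /=.
by rewrite !horner_affine; field.
Qed.

(** The relation moves each factor [u] outwards: the iterates of [u *: g] are those of [g] times
    powers of [u], the exponent passing from [e] to [d * e + 1] at each step. *)
Lemma julia_unity_root g u (d j : nat) : (0 < j)%N -> u ^+ j = 1 -> g \Po (u *: 'X) = u ^+ d *: g ->
  julia (u *: g) = julia g.
Proof.
move=> j0 uj gu; have u0 : u != 0.
  by apply: contra_eq_neq uj => ->; rewrite expr0n gtn_eqF // eq_sym oner_eq0.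
have gum m : g \Po (u ^+ m *: 'X) = u ^+ (d * m) *: g.
  elim: m => [|m IH]; first by rewrite muln0 !expr0 !scale1r comp_polyXr.
  have -> : u ^+ m.+1 *: 'X = (u ^+ m *: 'X) \Po (u *: 'X) :> {poly C}.
    by rewrite comp_polyZ comp_polyX scalerA exprSr.
  by rewrite comp_polyA IH comp_polyZ gu scalerA -exprD mulnSr.
have /boolp.choice[e he] : forall n, exists e, iterp (u *: g) n = u ^+ e *: iterp g n.
  elim=> [|n [e IH]]; first by exists 0%N; rewrite scale1r.
  exists (d * e).+1; rewrite !iterpS IH comp_polyZ exprS -scalerA; congr (_ *: _).
  have -> : u ^+ e *: iterp g n = (u ^+ e *: 'X) \Po iterp g n by rewrite comp_polyZ comp_polyX.
  by rewrite comp_polyA gum comp_polyZ.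
suff ef : Defs.fatou (u *: g) = Defs.fatou g by rewrite /julia ef.
apply/seteqP; split => z [U oU nU]; exists U => //; move: nU.
  apply: (@normal_on_unity_root _ _ _ u^-1 j e) => //; first by rewrite exprVn uj invr1.
  by move=> n w; rewrite he hornerZ exprVn mulKf ?expf_neq0.
apply: (@normal_on_unity_root _ _ _ u j e) => // n w.
by rewrite he hornerZ.
Qed.
End JuliaConjugation.

(** * Equivalence of iterates *)

Section SchwarzianEquivalence.
Variable R : realType.
Local Notation C := (CC R).
Implicit Types (a b z w c u v : C) (p q h L M f g : {poly C}).

Lemma horner_eq0 p : (forall z, p.[z] = 0) -> p = 0.
Proof.
move=> h; apply/eqP/negPn/negP => p0.
have [s1|s1] := leqP (size p) 1.
  by move: (h 0) p0; rewrite (size1_polyC s1) hornerC => ->; rewrite polyC0 eqxx.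
have [x] : exists x, root (p + 1) x.
  by apply/closed_rootP; rewrite size_polyDl ?size_poly1 // gtn_eqF.
by rewrite rootE hornerD h hornerC add0r oner_eq0.
Qed.

Lemma deriv_eq0_polyC p : p^`() = 0 -> p = (p`_0)%:P.
Proof.
move=> p'0; apply/polyP => -[|i]; rewrite coefC //=.
have /eqP := congr1 (fun q : {poly C} => q`_i) p'0.
by rewrite coef_deriv coef0 mulrn_eq0 /= => /eqP.
Qed.

Lemma deriv_neq0 p : (1 < size p)%N -> p^`() != 0.
Proof.
move=> sp; apply/eqP => /deriv_eq0_polyC e.
by move: sp; rewrite e ltnNge size_polyC_leq1.
Qed.

Lemma size_deriv_eq p q : size p = size q -> (1 < size p)%N -> size p^`() = size q^`().
Proof.
suff h (r : {poly C}) : (1 < size r)%N -> size r^`() = (size r).-1 by move=> e s; rewrite !h // -e.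
move=> sr; have r0 : r != 0 by rewrite -size_poly_gt0 ltnW.
have lt := lt_size_deriv r0.
apply: contraTeq isT => ne; rewrite /=.
have {}lt : (size r^`() <= (size r).-2)%N.
  move: sr lt ne; move: (size r) (size r^`()) => [|[|n]] //= m _.
  by rewrite ltnS leq_eqVlt => /orP[->|].
have : r^`()`_(size r).-2 != 0.
  have e : (size r).-2.+1 = (size r).-1 by case: (size r) sr => [|[]].
  by rewrite coef_deriv mulrn_eq0 /= e -lead_coefE lead_coef_eq0 (negPf r0).
by rewrite nth_default ?eqxx.
Qed.

Lemma deriv_comp_affine q a b : (q \Po affine a b)^`() = a *: (q^`() \Po affine a b).
Proof.
by rewrite deriv_comp /affine derivD derivZ derivX derivC addr0 alg_polyC mulrC mul_polyC.
Qed.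

Lemma schwarz_equivP p q : (1 < size p)%N -> size q = size p ->
  schwarz_equiv p q <-> affine_equiv p q.
Proof.
move=> sp sq.
split=> [[a [b [a0 h]]]|[L [M [/affineP [c [e [c0 ->]]] /affineP [a [b [a0 ->]]] ->]]]].
  pose H := q \Po affine a b.
  have sM : size (affine a b) = 2 by apply: size_affine.
  have sH : size H = size p by rewrite size_comp_poly2.
  have p'0 := deriv_neq0 sp; have H'0 : H^`() != 0 by apply: deriv_neq0; rewrite sH.
  have H1 : H^`() = a *: (q^`() \Po affine a b) by apply: deriv_comp_affine.
  have H2 : H^`(2) = a ^+ 2 *: (q^`(2) \Po affine a b).
    by rewrite derivnS derivn1 H1 derivZ deriv_comp_affine scalerA.
  have H3 : H^`(3) = a ^+ 3 *: (q^`(3) \Po affine a b).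
    by rewrite derivnS H2 derivZ deriv_comp_affine scalerA -exprSr.
  set P := p^`() in p'0; set Q := H^`() in H'0.
  (* The first bracket is twice the Schwarzian of [p] times [P ^+ 2], the second the same for [H]
     and [Q]; this is the Schwarzian identity with denominators cleared. *)
  have S : (P^`(2) * P *+ 2 - P^`() ^+ 2 *+ 3) * Q ^+ 2 =
           (Q^`(2) * Q *+ 2 - Q^`() ^+ 2 *+ 3) * P ^+ 2.
    apply/eqP; rewrite -subr_eq0; set D := _ - _.
    (* The identity is known only off the zeros of [P] and [Q]; the factor [P * Q] makes it hold
       everywhere. *)
    suff : D * (P * Q) = 0.
      by move/eqP; rewrite !mulf_eq0 (negPf p'0) (negPf H'0) !orbF.
    apply: horner_eq0 => z; rewrite !hornerM.
    have [->|Pz] := eqVneq P.[z] 0; first by rewrite mul0r mulr0.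
    have [->|Qz] := eqVneq Q.[z] 0; first by rewrite !mulr0.
    suff -> : D.[z] = 0 by rewrite mul0r.
    have qz : q^`().[a * z + b] != 0.
      move: Qz; rewrite /Q H1 hornerZ horner_comp horner_affine mulf_eq0 negb_or.
      by case/andP.
    have := h z Pz qz; rewrite /schwarzian => e.
    have d2 (r : {poly C}) : r^`()^`(2) = r^`(3) by rewrite !derivSn.
    have d1 (r : {poly C}) : r^`()^`() = r^`(2) by rewrite !derivSn.
    have T (r : {poly C}) : (r \Po affine a b).[z] = r.[a * z + b].
      by rewrite horner_comp horner_affine.
    rewrite /D /P /Q !d2 !d1 H1 H2 H3 !(hornerD, hornerN, hornerM, hornerMn, hornerZ, horner_exp, T).
    move: e Pz qz; rewrite /P; move: p^`().[z] p^`(2).[z] p^`(3).[z] => p1 p2 p3.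
    move: q^`().[a * z + b] q^`(2).[a * z + b] q^`(3).[a * z + b] => q1 q2 q3 e p10 q10.
    have -> : p3 =
        p1 * ((q3 / q1 - 3%:R / 2%:R * (q2 / q1) ^+ 2) * a ^+ 2 + 3%:R / 2%:R * (p2 / p1) ^+ 2).
      by rewrite -e subrK mulrC divfK.
    by field; rewrite q10 p10.
  have eP : P = (lead_coef P / lead_coef Q) *: Q.
    apply: wronskian_eq0_proportional => //; first by rewrite /P /Q; apply: size_deriv_eq.
    exact: schwarzian_eq_wronskian.
  set k := _ / _ in eP.
  have k0 : k != 0 by apply: contraNneq p'0 => k0; rewrite eP k0 scale0r.
  have dz : (p - k *: H)^`() = 0 by rewrite derivB derivZ -/P -/Q {1}eP subrr.
  have := deriv_eq0_polyC dz; move: (_`_0) => e0 e.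
  exists (k *: 'X + e0%:P), (affine a b); split => //; first exact: size_affine.
  by rewrite affine_comp -/H -e addrC subrK.
exists a, b; split => // z; rewrite affine_comp -/(affine a b).
set H := _ + _; have H1 : H^`() = (c * a) *: (q^`() \Po affine a b).
  by rewrite /H derivD derivC addr0 derivZ deriv_comp_affine scalerA.
have H2 : H^`(2) = (c * a ^+ 2) *: (q^`(2) \Po affine a b).
  by rewrite derivnS derivn1 H1 derivZ deriv_comp_affine scalerA -mulrA.
have H3 : H^`(3) = (c * a ^+ 3) *: (q^`(3) \Po affine a b).
  by rewrite derivnS H2 derivZ deriv_comp_affine scalerA -mulrA -exprSr.
move=> _; rewrite /schwarzian H1 H2 H3 !hornerZ !horner_comp horner_affine => q1.
by field; rewrite c0 q1 a0.
Qed.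

Lemma affine_equiv_comp p q L L' M M' : size L = 2 -> size L' = 2 -> size M = 2 -> size M' = 2 ->
  affine_equiv p q -> affine_equiv (L \Po (p \Po L')) (M \Po (q \Po M')).
Proof.
move=> sL sL' sM sM' [P [Q [sP sQ ->]]].
have [N [sN _ NM]] := affine_invP sM; have [N' [sN' MN' _]] := affine_invP sM'.
exists (L \Po (P \Po N)), (N' \Po (Q \Po L')); rewrite !size_comp_poly2 //; split=> //.
rewrite -!comp_polyA; congr (_ \Po (_ \Po _)).
by rewrite !comp_polyA NM comp_polyX -[(_ \Po M') \Po N']comp_polyA MN' comp_polyXr.
Qed.

Lemma conjpE f a b : conjp f a b = a^-1 *: ((f \Po affine a b) - b%:P).
Proof. by rewrite /conjp /affine_inv comp_polyZ comp_polyB comp_polyX comp_polyC. Qed.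

Lemma size_conjp f a b : (1 < size f)%N -> a != 0 -> size (conjp f a b) = size f.
Proof.
move=> sf a0; have s2 : size (affine a b) = 2 by apply: size_affine.
by rewrite conjpE size_scale ?invr_eq0 // size_subC size_comp_poly2.
Qed.
End SchwarzianEquivalence.

(** * Equivalence of the three conditions *)

Section StrongEquivalence.
Variable R : realType.
Local Notation C := (CC R).
Implicit Types (a b z w c u v : C) (p q h L M f g : {poly C}) (d n : nat).

Lemma infinite_nat_above (A : set nat) n : infinite_set A -> exists2 m, A m & (n <= m)%N.
Proof.
move=> iA; apply: contrapT => no; apply: iA.
apply: (@sub_finite_set _ _ `I_n); last exact: finite_II.
by move=> m Am /=; rewrite ltnNge; apply/negP => nm; apply: no; exists m.
Qed.

Lemma size_iterp f d n : size f = d.+1 -> (0 < d)%N -> size (iterp f n) = (d ^ n).+1.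
Proof. exact: size_iter_comp. Qed.

Lemma iterates_equivP f g d n : (1 < d)%N -> size f = d.+1 -> size g = d.+1 ->
  schwarz_equiv (iterp f n) (iterp g n) <-> affine_equiv (iterp f n) (iterp g n).
Proof.
move=> d1 sf sg; have d0 := ltnW d1.
by apply: schwarz_equivP; rewrite !(size_iterp _ sf, size_iterp _ sg) // ltnS expn_gt0 d0.
Qed.

Lemma often_always f g d : (1 < d)%N -> size f = d.+1 -> size g = d.+1 ->
  iterates_equiv_often f g -> iterates_equiv_always f g.
Proof.
move=> d1 sf sg often n n1.
have [m [m1 /(iterates_equivP _ d1 sf sg)[L [M [sL sM e]]]] nm] := infinite_nat_above n often.
apply/(iterates_equivP _ d1 sf sg).
have nm' : (0 < n <= m)%N by rewrite n1.
have [L' sL' e'] := iter_affine_descend d1 sf sg sL sM nm' e.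
by exists L', M.
Qed.

Lemma always_often f g : iterates_equiv_always f g -> iterates_equiv_often f g.
Proof.
move=> always; rewrite /iterates_equiv_often (_ : mkset _ = ~` [set 0%N]).
  by move=> fin; apply: infinite_nat; rewrite -(setUv [set 0%N]) finite_setU; split.
apply/seteqP; split => n /=; first by case=> n1 _ n0; rewrite n0 in n1.
by case: n => [|n] // _; split => //; apply: always.
Qed.

Lemma size_affine_inv a b : a != 0 -> size (affine_inv a b) = 2.
Proof. by move=> a0; rewrite /affine_inv size_scale ?invr_eq0 // size_XsubC. Qed.

Lemma conjp_centred f d : (1 < d)%N -> size f = d.+1 -> exists t, (conjp f 1 t)`_d.-1 = 0.
Proof.
move=> d1 sf; have d0 : d = d.-1.+1 by rewrite prednK // ltnW.
have fd : f`_d != 0.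
  by have := lead_coef_eq0 f; rewrite lead_coefE -size_poly_eq0 sf => ->.
(* This is the centroid of the zeros of [f]. The constant subtracted by the conjugation does not
   reach the index [d.-1], which is positive. *)
exists (- f`_d.-1 / (f`_d *+ d)); rewrite conjpE invr1 scale1r coefB coefC.
have -> : (d.-1 == 0)%N = false by move: d1; case: (d) => [|[|]].
rewrite subr0 /affine coef_comp_affine ?sf -?d0 // expr1n mul1r.
have nd : (d%:R : C) != 0 by rewrite pnatr_eq0 -lt0n ltnW.
by rewrite -[X in _ + X]mulr_natr -[f`_d *+ d]mulr_natr; field; rewrite nd fd.
Qed.

Lemma always_julia f g d : (1 < d)%N -> size f = d.+1 -> size g = d.+1 ->
  iterates_equiv_always f g -> julia_affine_equiv f g.
Proof.
move=> d1 sf sg always; have [s cs] := conjp_centred d1 sf; have [t ct] := conjp_centred d1 sg.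
have sf1 : (1 < size f)%N by rewrite sf ltnS ltnW.
have sg1 : (1 < size g)%N by rewrite sg ltnS ltnW.
have n10 : (1 : C) != 0 := oner_neq0 _.
have scf : size (conjp f 1 s) = d.+1 by rewrite size_conjp.
have scg : size (conjp g 1 t) = d.+1 by rewrite size_conjp.
have [|a [u [j [a0 j0 uj gu e]]]] := centred_iterates_conj d1 scf scg cs ct.
  move=> n n0; have := (iterates_equivP n d1 sf sg).1 (always n n0).
  rewrite -!/(iterp _ n) !iterp_conj // => h.
  by apply: affine_equiv_comp => //; rewrite ?size_affine_inv //; apply: size_affine.
have ec : conjp (conjp f 1 s) a^-1 0 = u *: conjp g 1 t.
  by rewrite -e conjpE invrK polyC0 subr0 /affine polyC0 addr0.
apply: (julia_affine_equiv_trans (julia_affine_equiv_conj f s n10)).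
have a'0 : a^-1 != 0 by rewrite invr_eq0.
apply: (julia_affine_equiv_trans (julia_affine_equiv_conj _ 0 a'0)); rewrite ec.
apply: julia_affine_equiv_sym.
apply: (julia_affine_equiv_trans (julia_affine_equiv_conj g t n10)).
exists 1, 0; split => //; rewrite (julia_unity_root j0 uj gu) -[RHS]image_id; congr (_ @` _).
by apply/funext => z; rewrite horner_affine mul1r addr0.
Qed.

Lemma julia_conj_pullback f g a b : a != 0 -> horner (affine a b) @` julia g = julia f ->
  forall z, julia g z <-> julia f (a * z + b).
Proof.
move=> a0 e z; rewrite -e; split => [Jz|[w Jw]]; first by exists z; rewrite ?horner_affine.
by rewrite horner_affine => /addIr/(mulfI a0) <-.
Qed.

Lemma julia_centre f : (2 < size f)%N -> exists c, forall p q, (1 < size p)%N -> size q = size p ->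
  (forall z, julia f p.[z] <-> julia f z) -> (forall z, julia f q.[z] <-> julia f z) ->
  exists2 u, `|u| = 1 & q - c%:P = u *: (p - c%:P).
Proof.
move=> sf; have [z [w [Jz Jw zw]]] := julia_two_points sf.
exact: invariant_centre (julia_compact sf) Jz Jw zw.
Qed.

Lemma julia_always f g d : (1 < d)%N -> size f = d.+1 -> size g = d.+1 ->
  julia_affine_equiv f g -> iterates_equiv_always f g.
Proof.
move=> d1 sf sg [a [b [a0 e]]] n n1; apply/(iterates_equivP _ d1 sf sg).
have sf2 : (2 < size f)%N by rewrite sf ltnS.
have sf1 := ltnW sf2; have sg1 : (1 < size g)%N by rewrite sg ltnS ltnW.
have pull := julia_conj_pullback a0 e.
have [c cP] := julia_centre sf2.
have sA : size (affine a b) = 2 by apply: size_affine.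
have sB := size_affine_inv b a0.
(* Conjugation by the map between the Julia sets makes [q] preserve that of [f]. *)
pose q := affine a b \Po (iterp g n \Po affine_inv a b).
have d0 := ltnW d1.
have sq : size q = size (iterp f n).
  have := size_comp_poly (affine a b) (iterp g n \Po affine_inv a b).
  rewrite (size_comp_poly2 (iterp g n) sB) sA mul1n (size_iterp _ sf) // (size_iterp _ sg) //.
  rewrite -/q /=; case: (size q) => [|k] /= e'; last by rewrite e'.
  by move: (expn_gt0 d n); rewrite -e' d0.
have [|z|z|u u1 eq] := cP (iterp f n) q _ sq.
- by rewrite (size_iterp _ sf) // ltnS expn_gt0 d0.
- exact: julia_iterp_invariant.
- rewrite /q !horner_comp horner_affine -pull; apply: iff_trans (julia_iterp_invariant _ _ sg1) _.
  by rewrite pull horner_affine_inv mulVKf // subrK.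
have u0 : u != 0 by rewrite -normr_eq0 u1 oner_eq0.
have ep : iterp f n = (u^-1 *: 'X + (c - u^-1 * c)%:P) \Po (q \Po 'X).
  rewrite comp_polyXr affine_comp -[q](subrK c%:P) eq scalerDr scalerA mulVf // scale1r.
  by rewrite -[u^-1 *: c%:P]mul_polyC polyCB polyCM; ring.
rewrite ep; have sL : size (u^-1 *: 'X + (c - u^-1 * c)%:P) = 2.
  by apply: size_affine; rewrite invr_eq0.
exists ((u^-1 *: 'X + (c - u^-1 * c)%:P) \Po affine a b), (affine_inv a b); split => //.
  by rewrite size_comp_poly2.
by rewrite comp_polyXr comp_polyA.
Qed.
End StrongEquivalence.

(** * Conjugacy classes *)

Section ConjugacyClasses.
Variable R : realType.
Local Notation C := (CC R).
Implicit Types (a b z w c u v : C) (p q h L M f g : {poly C}) (d n : nat).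

Lemma affine_comp_affine a b a' b' :
  affine a b \Po affine a' b' = affine (a * a') (a * b' + b) :> {poly C}.
Proof.
rewrite /affine affine_comp scalerDr scalerA -addrA; congr (_ + _).
by rewrite polyCD polyCM mul_polyC.
Qed.

Lemma affine_inv_affine a b : affine_inv a b = affine a^-1 (- (a^-1 * b)) :> {poly C}.
Proof. by rewrite /affine_inv /affine scalerBr -[_ *: b%:P]mul_polyC -polyCM polyCN. Qed.

Lemma affine_conj_trans f g h : affine_conj f g -> affine_conj g h -> affine_conj f h.
Proof.
move=> [a [b [a0 ->]]] [a' [b' [a'0 ->]]]; exists (a * a'), (a * b' + b).
rewrite mulf_neq0 //; split=> //.
have <- : affine_inv a' b' \Po affine_inv a b = affine_inv (a * a') (a * b' + b).
  by rewrite !affine_inv_affine affine_comp_affine; congr (affine _ _); field; rewrite a0 a'0.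
by rewrite -affine_comp_affine -!comp_polyA.
Qed.

Lemma affine_conj_sym f g : affine_conj f g -> affine_conj g f.
Proof.
move=> [a [b [a0 ->]]]; exists a^-1, (- b / a); rewrite invr_eq0; split=> //.
by rewrite -[LHS](conjpK f b a0).
Qed.

Lemma affine_conj_refl f : affine_conj f f.
Proof.
exists 1, 0; rewrite oner_neq0; split => //.
by rewrite /affine_inv /affine invr1 !scale1r polyC0 subr0 addr0 comp_polyXr comp_polyX.
Qed.

Lemma conj_class_eq f g : affine_conj f g -> conj_class f = conj_class g.
Proof.
move=> fg; apply/seteqP; split => h /=; apply: affine_conj_trans => //.
exact: affine_conj_sym.
Qed.

Lemma conj_class_conjp f a b : a != 0 -> conj_class (conjp f a b) = conj_class f.
Proof. by move=> a0; apply/esym/conj_class_eq; exists a, b. Qed.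

Definition rotation u c : {poly C} := affine u (c - u * c).

Lemma rotation_comp u c f : rotation u c \Po f = u *: (f - c%:P) + c%:P.
Proof.
rewrite /rotation /affine affine_comp scalerBr -[u *: c%:P]mul_polyC polyCB polyCM; ring.
Qed.

Lemma affine_julia_equiv f g d : (1 < d)%N -> size f = d.+1 -> size g = d.+1 ->
  julia_affine_equiv f g -> strong_equiv f g.
Proof.
move=> d1 sf sg e; have always := julia_always d1 sf sg e.
by split => //; apply: always_often.
Qed.

Lemma strong_class_saturated f d : (1 < d)%N -> size f = d.+1 ->
  strong_class f = \bigcup_(E in conj_classes_in f) E.
Proof.
move=> d1 sf; apply/seteqP; split => [g fg|h].
  by exists (conj_class g); [exists g|exact: affine_conj_refl].
move=> [_ [g [sg [_ _ jfg]] <-] [a [b [a0 eh]]]].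
have sg1 : (1 < size g)%N by rewrite sg sf ltnS ltnW.
have eh' : h = conjp g a b by [].
have sh : size h = size f by rewrite eh' size_conjp.
split => //; apply: (affine_julia_equiv d1) => //; first by rewrite sh.
apply: julia_affine_equiv_trans jfg _; rewrite eh'; exact: julia_affine_equiv_conj.
Qed.

Section FixedPolynomial.
Variables (f : {poly C}) (d : nat) (c : C).
Hypotheses (d_gt1 : (1 < d)%N) (sf : size f = d.+1).
Hypothesis centre : forall p q, (1 < size p)%N -> size q = size p ->
  (forall z, julia f p.[z] <-> julia f z) -> (forall z, julia f q.[z] <-> julia f z) ->
  exists2 u, `|u| = 1 & q - c%:P = u *: (p - c%:P).

Let sf1 : (1 < size f)%N. Proof. by rewrite sf ltnS ltnW. Qed.

Let surjective p w : (1 < size p)%N -> exists z, p.[z] = w.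
Proof.
move=> sp; have /closed_rootP[z] : size (p - w%:P) != 1.
  by rewrite size_subC // gtn_eqF.
by rewrite rootE hornerD hornerN hornerC subr_eq0 => /eqP; exists z.
Qed.

Lemma class_representative g : strong_class f g -> exists u, [/\ `|u| = 1,
  conj_class g = conj_class (rotation u c \Po f) &
  horner (rotation u c) @` julia f = julia f].
Proof.
move=> [sg [_ _ [a [b [a0 e]]]]]; have pull := julia_conj_pullback a0 e.
have sg1 : (1 < size g)%N by rewrite sg.
have a'0 : a^-1 != 0 by rewrite invr_eq0.
pose g1 := conjp g a^-1 (- b / a).
have Jg1 z : julia g1 z <-> julia f z.
  apply: iff_trans (julia_conj _ _ _ a'0) _; rewrite pull.
  by have -> : a * (a^-1 * z + - b / a) + b = z by field.
have inv1 z : julia f g1.[z] <-> julia f z.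
  by rewrite -!Jg1; apply: julia_invariant; rewrite size_conjp.
have [|z|u u1 eg1] := centre sf1 _ _ inv1; [by rewrite size_conjp|exact: julia_invariant|].
have {}eg1 : g1 = rotation u c \Po f by rewrite rotation_comp -eg1 subrK.
exists u; split => //; first by rewrite -eg1 conj_class_conjp.
(* The rotation sends [f.[z]] to [g1.[z]], and both [f] and [g1] map the Julia set of [f] onto
   itself. *)
apply/seteqP; split => [_ [w Jw <-]|w Jw].
  have [z fz] := surjective w sf1.
  have -> : (rotation u c).[w] = g1.[z] by rewrite eg1 horner_comp fz.
  by apply/inv1/(julia_invariant _ sf1); rewrite fz.
have sg1' : (1 < size g1)%N by rewrite size_conjp.
have [z gz] := surjective w sg1'; exists f.[z]; last by rewrite -horner_comp -eg1.
by apply/(julia_invariant _ sf1)/inv1; rewrite gz.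
Qed.

Lemma conj_classes_card : (conj_classes_in f #<= symmetry_group (julia f))%card.
Proof.
(* A symmetry is given as a function; its values at 0 and 1 recover the coefficients of the affine
   map. *)
pose F (s : C -> C) := conj_class (affine (s 1 - s 0) (s 0) \Po f).
apply: (@card_le_trans _ _ _ (F @` symmetry_group (julia f))); last exact: card_image_le.
apply: subset_card_le => _ [g /class_representative[u [u1 eg sym]] <-].
exists (fun z => u * z + (c - u * c)).
  exists u, (c - u * c); split => //; split => //; rewrite -[RHS]sym; congr (_ @` _).
  by apply/funext => z; rewrite horner_affine.
by rewrite /F eg mulr0 add0r mulr1 addrK.
Qed.

(** With [c] moved to 0, rotations about [c] become homotheties and act on coefficients by powers of
    [u]. *)
Let f0 := conjp f 1 c.

Let f0E : f0 = (f \Po affine 1 c) - c%:P.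
Proof. by rewrite /f0 conjpE invr1 scale1r. Qed.

Let size_f0 : size f0 = d.+1. Proof. by rewrite size_conjp ?oner_neq0. Qed.

Let lead_f0 : f0`_d != 0.
Proof. by have := lead_coef_eq0 f0; rewrite lead_coefE -size_poly_eq0 size_f0 => ->. Qed.

(** Both [f] and [f \Po rotation u c] leave the Julia set completely invariant, so [centre] applies
    to this pair. *)
Let symmetry_commutes u : `|u| = 1 -> horner (rotation u c) @` julia f = julia f ->
  exists t, f0 \Po (u *: 'X) = t *: f0.
Proof.
move=> u1 sym; have u0 : u != 0 by rewrite -normr_eq0 u1 oner_eq0.
have sr : size (rotation u c) = 2 by apply: size_affine.
have inv z : julia f (rotation u c).[z] <-> julia f z.
  by rewrite horner_affine; apply: iff_sym; exact: julia_conj_pullback u0 sym z.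
have [||z|t _ e] := centre sf1 (q := f \Po rotation u c).
- by rewrite size_comp_poly2.
- by move=> z; exact: julia_invariant.
- by rewrite horner_comp; apply: iff_trans (julia_invariant _ sf1) (inv z).
exists t; rewrite f0E comp_polyB comp_polyC -comp_polyA.
have -> : affine 1 c \Po (u *: 'X) = rotation u c \Po affine 1 c.
  have -> : u *: 'X = affine u 0 by rewrite /affine polyC0 addr0.
  by rewrite /rotation !affine_comp_affine; congr (affine _ _); ring.
have := congr1 (comp_poly (affine 1 c)) e.
by rewrite comp_polyB comp_polyZ comp_polyB !comp_polyC comp_polyA.
Qed.

(** The symmetry group can be infinite, so finiteness is a separate matter. A nonzero coefficient of
    [f0] at some [k < d] gives [u ^+ k = u ^+ d], which leaves finitely many [u]; if [f0] is a
    monomial, all the rotated polynomials are conjugate to [f]. *)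
Lemma conj_classes_finite : finite_set (conj_classes_in f).
Proof.
have [[k kd fk]|no] := pselect (exists2 k, (k < d)%N & f0`_k != 0).
  have [s es] := closed_field_poly_normal ('X^(d - k) - 1 : {poly C}).
  apply: (@sub_finite_set _ _ ((fun u => conj_class (rotation u c \Po f)) @` [set` s])); last first.
    by apply: finite_image; exact: finite_seq.
  move=> _ [g /class_representative[u [u1 eg sym]] <-]; exists u => //=.
  have [t ht] := symmetry_commutes u1 sym.
  have ut i : u ^+ i * f0`_i = t * f0`_i by rewrite -coef_comp_scale ht coefZ.
  have uk := mulIf fk (ut k); have ud := mulIf lead_f0 (ut d).
  have u0 : u != 0 by rewrite -normr_eq0 u1 oner_eq0.
  have u1' : u ^+ (d - k) = 1.
    apply: (mulIf (expf_neq0 k u0)); rewrite -exprD subnK ?(ltnW kd) // ud uk.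
    by rewrite mul1r.
  rewrite -root_prod_XsubC -(rootZ _ _ (a := lead_coef ('X^(d - k) - 1 : {poly C}))).
    by rewrite -es rootE hornerD hornerN hornerC hornerXn u1' subrr.
  by rewrite lead_coef_eq0 -size_poly_eq0 size_XnsubC // subn_gt0.
have ef0 : f0 = lead_coef f0 *: 'X^d.
  apply: eq_lead_monomial => // i id; apply/eqP/negPn/negP => fi; apply: no; by exists i.
apply: (@sub_finite_set _ _ [set conj_class f]); last exact: finite_set1.
move=> _ [g /class_representative[u [u1 -> _]] <-] /=.
have n10 : (1 : C) != 0 := oner_neq0 _.
have u0 : u != 0 by rewrite -normr_eq0 u1 oner_eq0.
have pd : (0 < d.-1)%N by rewrite -ltnS prednK // ltnW.
(* Conjugating the monomial [f0] by the homothety [l] multiplies it by [l ^+ d.-1 = u]. *)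
pose l := d.-1.-root u; have ld : l ^+ d.-1 = u by apply: rootCK.
have l0 : l != 0.
  have : l ^+ d.-1 != 0 by rewrite ld.
  by rewrite expf_eq0 pd.
rewrite -(conj_class_conjp (rotation u c \Po f) c n10).
have -> : conjp (rotation u c \Po f) 1 c = u *: f0.
  rewrite conjpE invr1 scale1r f0E -comp_polyA rotation_comp addrK //.
rewrite -[RHS](conj_class_conjp f c n10) -/f0 -[RHS](conj_class_conjp f0 0 l0).
congr conj_class; rewrite conjpE polyC0 subr0 /affine polyC0 addr0 {1}ef0 [in RHS]ef0.
rewrite comp_polyZ comp_Xn_poly exprZn !scalerA; congr (_ *: _).
have -> : l ^+ d = l * u by rewrite -ld -exprS prednK // ltnW.
by field.
Qed.

End FixedPolynomial.
End ConjugacyClasses.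

Theorem theorem1p3 (R : realType) (d : nat) (hd : (2 <= d)%N) :
  (forall f g : {poly CC R}, size f = d.+1 -> size g = d.+1 ->
     (iterates_equiv_often f g <-> iterates_equiv_always f g) /\
     (iterates_equiv_always f g <-> julia_affine_equiv f g)) /\
  (forall f : {poly CC R}, size f = d.+1 ->
     [/\ strong_class f = \bigcup_(E in conj_classes_in f) E,
         finite_set (conj_classes_in f) &
         conj_classes_in f #<= symmetry_group (julia f)]).
Proof.
split=> [f g sf sg|f sf].
  split; split; first exact: often_always hd sf sg.
  - exact: always_often.
  - exact: always_julia hd sf sg.
  - exact: julia_always hd sf sg.
have [|c centre] := @julia_centre R f; first by rewrite sf.
split; first exact: strong_class_saturated hd sf.
  exact: conj_classes_finite hd sf centre.
exact: conj_classes_card hd sf centre.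
Qed.
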